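(* Let $G$ be an $S_{2,2,4}$-free bipartite graph with $n$ vertices. Then the Efficient Domination problem for $G$ can be solved in time $O(n^6)$.
   Context: For a graph $G=(V,E)$ and $v\in V$, $N[v]$ is the closed neighborhood of $v$. A set $D\subseteq V$ is an efficient dominating set (e.d.s.) if $|N[v]\cap D|=1$ for every $v\in V$; the Efficient Domination problem asks whether $G$ has an e.d.s. For $i,j,k\ge 0$, $S_{i,j,k}$ is the graph with vertices $u,x_1,\dots,x_i,y_1,\dots,y_j,z_1,\dots,z_k$ whose edges are exactly those of the three paths $u,x_1,\dots,x_i$; $u,y_1,\dots,y_j$; $u,z_1,\dots,z_k$ (a subdivided claw with center $u$). A graph is $H$-free if it has no induced subgraph isomorphic to $H$. *)

(* Defs.v *)
From mathcomp Require Import all_boot.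

Set Implicit Arguments.
Unset Strict Implicit.
Unset Printing Implicit Defensive.

Section Graphs.

Variable T : finType.
Implicit Type e : rel T.

Definition simple_graph e : Prop := symmetric e /\ irreflexive e.

Definition bipartite e : Prop :=
  exists A : {set T}, forall x y, e x y -> (x \in A) != (y \in A).

Definition closed_nbhd e (v : T) : {set T} := [set w | (w == v) || e v w].

Definition efficient_dominating_set e (D : {set T}) : Prop :=
  forall v, #|closed_nbhd e v :&: D| = 1.

Definition has_eds e : Prop := exists D, efficient_dominating_set e D.

Definition induced_free (S : finType) (h : rel S) e : Prop :=
  ~ exists f : S -> T, injective f /\ forall x y, e (f x) (f y) = h x y.

End Graphs.

(* [None] is the center u; the summands are x_1..x_i, y_1..y_j and z_1..z_k,
   shifted to indices starting at 0. *)
Definition spider_vertex (i j k : nat) : finType :=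
  option ('I_i + 'I_j + 'I_k)%type.

(* The edges of S_{i,j,k}, oriented away from the center. *)
Definition spider_arc (i j k : nat) (v w : spider_vertex i j k) : bool :=
  match v, w with
  | None, Some (inl (inl b)) => b == 0 :> nat
  | None, Some (inl (inr b)) => b == 0 :> nat
  | None, Some (inr b) => b == 0 :> nat
  | Some (inl (inl a)), Some (inl (inl b)) => b == a.+1 :> nat
  | Some (inl (inr a)), Some (inl (inr b)) => b == a.+1 :> nat
  | Some (inr a), Some (inr b) => b == a.+1 :> nat
  | _, _ => false
  end.

Definition spider (i j k : nat) : rel (spider_vertex i j k) :=
  [rel v w | spider_arc v w || spider_arc w v].
Arguments spider : clear implicits.

(* Running time is measured on a word RAM: finitely many registers (those the
   program mentions) and an addressable memory, every cell holding a word,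
   i.e. a natural number below a bound W, with unit-cost word operations.
   Control flow is structured.  A run in which a value reaches W is stuck: it
   has no [exec] derivation. *)
Inductive word_op := OpAdd | OpSub | OpMul | OpDiv | OpMod | OpEq | OpLt.

Definition apply_op (o : word_op) (a b : nat) : nat :=
  match o with
  | OpAdd => a + b
  | OpSub => a - b
  | OpMul => a * b
  | OpDiv => a %/ b
  | OpMod => a %% b
  | OpEq => a == b
  | OpLt => a < b
  end.

Inductive expr :=
  | Const of nat
  | Reg of nat
  | Read of expr
  | Op of word_op & expr & expr.

Inductive cmd :=
  | Skip
  | Assign of nat & expr
  | Write of expr & expr
  | Seq of cmd & cmd
  | If of expr & cmd & cmd
  | While of expr & cmd.

Record state := State { regs : nat -> nat; mem : nat -> nat }.

Definition update (f : nat -> nat) (a v : nat) : nat -> nat :=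
  fun b => if b == a then v else f b.

Definition set_reg (s : state) x v := State (update (regs s) x v) (mem s).
Definition set_mem (s : state) a v := State (regs s) (update (mem s) a v).

Definition word (W v : nat) : option nat := if v < W then Some v else None.

Fixpoint eval (W : nat) (s : state) (E : expr) : option nat :=
  match E with
  | Const v => word W v
  | Reg x => word W (regs s x)
  | Read A => if eval W s A is Some a then word W (mem s a) else None
  | Op o A B =>
      match eval W s A, eval W s B with
      | Some a, Some b => word W (apply_op o a b)
      | _, _ => None
      end
  end.

Fixpoint cost (E : expr) : nat :=
  match E with
  | Const _ | Reg _ => 1
  | Read A => (cost A).+1
  | Op _ A B => (cost A + cost B).+1
  end.

(* [exec W c s t s'] : with word bound W, command c started in state s halts
   in state s' after t time units. *)
Inductive exec (W : nat) : cmd -> state -> nat -> state -> Prop :=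
  | exec_skip s : exec W Skip s 1 s
  | exec_assign x E s v :
      eval W s E = Some v -> exec W (Assign x E) s (cost E).+1 (set_reg s x v)
  | exec_write A E s a v :
      eval W s A = Some a -> eval W s E = Some v ->
      exec W (Write A E) s (cost A + cost E).+1 (set_mem s a v)
  | exec_seq c1 c2 s s1 s2 t1 t2 :
      exec W c1 s t1 s1 -> exec W c2 s1 t2 s2 ->
      exec W (Seq c1 c2) s (t1 + t2) s2
  | exec_if E c1 c2 s v t s' :
      eval W s E = Some v -> exec W (if v != 0 then c1 else c2) s t s' ->
      exec W (If E c1 c2) s ((cost E).+1 + t) s'
  | exec_while_end E c s :
      eval W s E = Some 0 -> exec W (While E c) s (cost E).+1 s
  | exec_while_step E c s v s1 s2 t1 t2 :
      eval W s E = Some v -> v != 0 ->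
      exec W c s t1 s1 -> exec W (While E c) s1 t2 s2 ->
      exec W (While E c) s ((cost E).+1 + t1 + t2) s2.

(* Input: n in register 0, the adjacency matrix row by row in memory cells
   0 .. n^2 - 1, zero elsewhere. *)
Definition adj_mem (n : nat) (e : rel 'I_n) (a : nat) : nat :=
  [exists i : 'I_n, exists j : 'I_n, (a == i * n + j) && e i j].

Definition input (n : nat) (e : rel 'I_n) : state :=
  State (fun x => if x == 0 then n else 0) (adj_mem e).

(* The word bound (n + 2)^k means words of k log2(n + 2) = O(log n) bits.
   The answer is read off register 0.  Nothing is required of the program on
   graphs outside the class C. *)
Definition solves_in_time (C Q : forall n : nat, rel 'I_n -> Prop)
    (p : cmd) (k : nat) (t : nat -> nat) : Prop :=
  forall (n : nat) (e : rel 'I_n), simple_graph e -> C n e ->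
    exists (m : nat) (s : state),
      [/\ exec ((n + 2) ^ k) p (input e) m s, m <= t n
        & regs s 0 <> 0 <-> Q n e].

Definition bigO (f g : nat -> nat) : Prop :=
  exists c n0 : nat, forall n, n0 <= n -> f n <= c * g n.

(* Some fixed program decides Q on all simple graphs of class C in time
   O(f(n)), n being the number of vertices. *)
Definition solvable_in_time (C Q : forall n : nat, rel 'I_n -> Prop)
    (f : nat -> nat) : Prop :=
  exists (p : cmd) (k : nat) (t : nat -> nat),
    bigO t f /\ solves_in_time C Q p k t.

(* Main.v *)
From Stdlib Require Import Classical.
From mathcomp Require Import all_boot zify.
Require Import Defs.

Set Implicit Arguments.
Unset Strict Implicit.
Unset Printing Implicit Defensive.

(* Let D be an e.d.s. and R a subset of D, and take breadth-first levels from
   R.  Going through the vertices w level by level, an undominated w must be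
   dominated by a vertex one level further out.  If v1 in D dominates w and v2
   is another candidate, then v2 has a private neighbour u2 in D further out;
   if v1 also has a private neighbour u1 further out, then w is the center of
   an induced path u1 v1 w v2 u2, called a fork below.  Without forks v1 is
   the candidate with the fewest neighbours further out, and D is recovered
   from R greedily in time O(n^2).

   A fork together with an induced path of four more vertices leaving w
   towards the roots is an S_{2,2,4}.  Hence forks occur only close to R, and
   each fork that does occur yields new members of D at distance 3 from old
   ones, which serve as further roots.  At most four roots are needed before
   forks become impossible, so the algorithm tries all n^4 choices of R. *)

(** * Bounded-loop programs *)

(** The obstacle is a fork at level 3 or 4, where the way to the root is too short for a leg of four
    vertices. A path of length three to a second root prolongs it. This excludes level 4, and at
    level 3 it forces some neighbour of the center next to the first root to be complete to the
    neighbourhood of the second. The initial root has no such partner, so the first fork replaces it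
    by its own two members of D, which are at distance 3. Each later fork adds one root, and its
    private neighbour is too far out for such completeness.

    The graph may be disconnected, and four roots cannot serve all components. One search therefore
    certifies only the vertices that it reaches, and only after checking them; the solutions of the
    components are glued at the end. The same check makes wrong guesses harmless.

    All loops run n rounds, so the exponent of the running time is the nesting depth: four loops for
    the guesses and two inside a search. *)

Inductive prog :=
  | PSkip
  | PSet of nat & expr
  | PPut of nat & expr & expr
  | PSeq of prog & prog
  | PIf of expr & prog & prog
  | PFor of nat & prog.

(* Eight arrays are interleaved above the adjacency matrix: entry i of array j
   lies at n^2 + 8 i + j, so distinct arrays never collide, even when an index
   is out of range. *)
Definition addr (j : nat) (X : expr) : expr :=
  Op OpAdd (Op OpAdd (Op OpMul (Reg 0) (Reg 0)) (Op OpMul (Const 8) X)) (Const j).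

Definition Cell (j : nat) (X : expr) : expr := Read (addr j X).
Definition Adj (X Y : expr) : expr := Read (Op OpAdd (Op OpMul X (Reg 0)) Y).

Definition loop_test (x : nat) : expr := Op OpLt (Reg x) (Reg 0).
Definition succ_reg (x : nat) : expr := Op OpAdd (Reg x) (Const 1).

Fixpoint compile (p : prog) : cmd :=
  match p with
  | PSkip => Skip
  | PSet x E => Assign x E
  | PPut j X E => Write (addr j X) E
  | PSeq p q => Seq (compile p) (compile q)
  | PIf E p q => If E (compile p) (compile q)
  | PFor x p =>
      Seq (Assign x (Const 0))
        (While (loop_test x) (Seq (compile p) (Assign x (succ_reg x))))
  end.

Fixpoint ev (s : state) (E : expr) : nat :=
  match E with
  | Const v => v
  | Reg x => regs s x
  | Read A => mem s (ev s A)
  | Op o A B => apply_op o (ev s A) (ev s B)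
  end.

Fixpoint sem (p : prog) (s : state) : state :=
  match p with
  | PSkip => s
  | PSet x E => set_reg s x (ev s E)
  | PPut j X E => set_mem s (ev s (addr j X)) (ev s E)
  | PSeq p q => sem q (sem p s)
  | PIf E p q => if ev s E != 0 then sem p s else sem q s
  | PFor x p =>
      iter (regs s 0) (fun s' => set_reg (sem p s') x (regs (sem p s') x).+1)
        (set_reg s x 0)
  end.

(** In a loop, 6 is 2 for resetting the counter plus 4 for the last, failing test; each round pays 4
    for its test and 4 for the increment. A conditional is charged for both branches, which makes
    the bound depend on n alone. *)
Fixpoint time (n : nat) (p : prog) : nat :=
  match p with
  | PSkip => 1
  | PSet x E => (cost E).+1
  | PPut j X E => (cost (addr j X) + cost E).+1
  | PSeq p q => time n p + time n q
  | PIf E p q => (cost E).+1 + (time n p + time n q)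
  | PFor x p => 6 + n * (time n p + 8)
  end.

Fixpoint assigns (x : nat) (p : prog) : bool :=
  match p with
  | PSet y _ => x == y
  | PSeq p q | PIf _ p q => assigns x p || assigns x q
  | PFor y p => (x == y) || assigns x p
  | _ => false
  end.

Fixpoint writes (j : nat) (p : prog) : bool :=
  match p with
  | PPut k _ _ => j == k
  | PSeq p q | PIf _ p q => writes j p || writes j q
  | PFor _ p => writes j p
  | _ => false
  end.

Fixpoint small (E : expr) : bool :=
  match E with
  | Const v => v <= 8
  | Reg _ => true
  | Read A => small A
  | Op _ A B => small A && small B
  end.

(* Expressions whose value exceeds the largest stored value by at most 1. *)
Definition tame (E : expr) : bool :=
  match E with
  | Const _ | Reg _ | Read _ => true
  | Op OpAdd (Reg _) (Const v) | Op OpAdd (Read _) (Const v) => v <= 1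
  | Op OpEq _ _ | Op OpLt _ _ => true
  | _ => false
  end.

Fixpoint wf (p : prog) : bool :=
  match p with
  | PSkip => true
  | PSet x E => [&& x != 0, small E & tame E]
  | PPut j X E => [&& j < 8, small X, small E & tame E]
  | PSeq p q => wf p && wf q
  | PIf E p q => [&& small E, wf p & wf q]
  | PFor x p => [&& x != 0, ~~ assigns x p & wf p]
  end.

(** An exponent rather than a time: over stored values up to m, all expressions of [p] stay below (m
    + 2) to this power. *)
Fixpoint max_cost (p : prog) : nat :=
  match p with
  | PSkip => 0
  | PSet x E => cost E
  | PPut j X E => cost (addr j X) + cost E
  | PSeq p q => max_cost p + max_cost q
  | PIf E p q => cost E + (max_cost p + max_cost q)
  | PFor x p => 3 + max_cost p
  end.

Definition state_le (s : state) (m : nat) : Prop :=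
  (forall x, regs s x <= m) /\ (forall a, mem s a <= m).

Lemma state_le_trans s m m' : state_le s m -> m <= m' -> state_le s m'.
Proof. by move=> [h1 h2] le; split=> x; apply: leq_trans le. Qed.

Lemma state_le_set_reg s m x v :
  state_le s m -> v <= m -> state_le (set_reg s x v) m.
Proof. by move=> [h1 h2] le; split=> y //=; rewrite /update; case: eqP. Qed.

Lemma state_le_set_mem s m a v :
  state_le s m -> v <= m -> state_le (set_mem s a v) m.
Proof. by move=> [h1 h2] le; split=> y //=; rewrite /update; case: eqP. Qed.

Lemma cost_gt0 E : 0 < cost E.
Proof. by case: E. Qed.

(** The unit of cost of an operator buys a factor m + 2, which lets the product of the bounds of
    both arguments also bound their sum. *)
Lemma ev_lt s m E :
  state_le s m -> 8 <= m -> small E -> ev s E < (m + 2) ^ cost E.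
Proof.
move=> [hr hm] m8.
have B0 : 0 < m + 2 by lia.
elim: E => [v|x|A IH|o A IHA B IHB] /=; rewrite ?expn1.
- lia.
- by move=> _; have := hr x; lia.
- move=> _; rewrite expnS; have := hm (ev s A).
  have : 0 < (m + 2) ^ cost A by rewrite expn_gt0 B0.
  by nia.
case/andP=> /IHA a_lt /IHB b_lt; rewrite expnS expnD.
move: a_lt b_lt; set a := ev s A; set b := ev s B.
set p := _ ^ _; set q := _ ^ _ => a_lt b_lt.
have pq : p * q <= (m + 2) * (p * q) by rewrite leq_pmull.
have p_le : p <= p * q by rewrite leq_pmulr //; lia.
have q_le : q <= p * q by rewrite leq_pmull //; lia.
have pq2 : p + q <= (m + 2) * (p * q).
  by apply: leq_trans (_ : 2 * (p * q) <= _); [lia | rewrite leq_mul2r; lia].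
have := leq_div a b; have := leq_mod a b; have := ltn_mul a_lt b_lt.
by case: o => /=; lia.
Qed.

Lemma eval_ev W s m E :
    state_le s m -> 8 <= m -> small E -> (m + 2) ^ cost E <= W ->
  eval W s E = Some (ev s E).
Proof.
move=> sm m8; have wordP F : small F -> (m + 2) ^ cost F <= W ->
    word W (ev s F) = Some (ev s F).
  move=> sF leW; rewrite /word.
  by rewrite (leq_trans (ev_lt sm m8 sF) leW).
elim: E => [v|x|A IH|o A IHA B IHB] sE leW.
- exact: (wordP (Const v)).
- exact: (wordP (Reg x)).
- rewrite /= IH //; first exact: (wordP (Read A)).
  by apply: leq_trans leW; rewrite leq_exp2l //=; lia.
case/andP: (sE) => sA sB.
rewrite /= IHA ?IHB //; first exact: (wordP (Op o A B)).
  by apply: leq_trans leW; rewrite leq_exp2l //=; lia.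
by apply: leq_trans leW; rewrite leq_exp2l //=; lia.
Qed.

Lemma ev_tame s m E :
  state_le s m -> 8 <= m -> small E -> tame E -> ev s E <= m.+1.
Proof.
move=> [hr hm] m8; case: E => [v|x|A|o A B] //=.
- by move=> ? _; lia.
- by move=> _ _; have := hr x; lia.
- by move=> _ _; have := hm (ev s A); lia.
case: o => //= _; try by (case: eqP; lia).
  case: A => //= [x|A]; case: B => //= v v1.
    by have := hr x; lia.
  by have := hm (ev s A); lia.
by case: (_ < _); lia.
Qed.

Lemma sem_reg y p s : ~~ assigns y p -> regs (sem p s) y = regs s y.
Proof.
elim: p s => //=.
- by move=> x E s; rewrite /update => /negbTE->.
- by move=> p IHp q IHq s; rewrite negb_or => /andP[/IHp Hp /IHq Hq]; rewrite Hq Hp.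
- move=> E p IHp q IHq s; rewrite negb_or => /andP[/IHp Hp /IHq Hq].
  by case: ifP.
move=> x p IHp s; rewrite negb_or => /andP[yx /IHp Hp].
elim: (regs s 0) => [|k IHk] /=; first by rewrite /update (negbTE yx).
by rewrite {1}/update (negbTE yx) Hp.
Qed.

Lemma wf_assigns0 p : wf p -> ~~ assigns 0 p.
Proof.
elim: p => //= [x E|p IHp q IHq|E p IHp q IHq|x p IHp].
- by rewrite eq_sym => /and3P[].
- by case/andP=> /IHp/negbTE-> /IHq/negbTE->.
- by case/and3P=> _ /IHp/negbTE-> /IHq/negbTE->.
- by case/and3P=> x0 _ /IHp/negbTE->; rewrite eq_sym (negbTE x0).
Qed.

Lemma sem_reg0 p s : wf p -> regs (sem p s) 0 = regs s 0.
Proof. by move=> /wf_assigns0; apply: sem_reg. Qed.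


(** Values and time are bounded together: a tame assignment raises the largest stored value by at
    most 1, so the bound grows no faster than the time, and in turn it keeps every expression below
    [W], so that the run is never stuck. *)
Lemma exec_sem W m p s :
    wf p -> state_le s m -> 8 <= m ->
    (m + time (regs s 0) p + 2) ^ max_cost p <= W ->
  state_le (sem p s) (m + time (regs s 0) p) /\
  exists2 t, t <= time (regs s 0) p & exec W (compile p) s t (sem p s).
Proof.
elim: p s m => [|x E|j X E|p IHp q IHq|E p IHp q IHq|x p IHp] s m.
- move=> _ sm _ _; split; first by apply: state_le_trans sm _; lia.
  by exists 1 => //; apply: exec_skip.
- move=> /and3P[x0 sE tE] sm m8 leW.
  have evE := ev_tame sm m8 sE tE.
  split.
    apply: state_le_set_reg; first by apply: state_le_trans sm _; lia.
    by move: evE => /=; lia.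
  exists (cost E).+1 => //; apply: exec_assign; apply: (eval_ev sm) => //.
  by apply: leq_trans leW; rewrite /= leq_exp2r ?cost_gt0 //; lia.
- move=> /and4P[j8 sI sE tE] sm m8 leW.
  have evE := ev_tame sm m8 sE tE.
  split.
    apply: state_le_set_mem; first by apply: state_le_trans sm _; lia.
    by move: evE => /=; lia.
  have leW' F : 0 < cost F -> cost F <= max_cost (PPut j X E) -> (m + 2) ^ cost F <= W.
    move=> F0 le; apply: leq_trans leW.
    apply: leq_trans (_ : (m + 2) ^ max_cost (PPut j X E) <= _).
      by rewrite leq_exp2l //; lia.
    by rewrite leq_exp2r; lia.
  exists (cost (addr j X) + cost E).+1 => //; apply: exec_write.
    apply: (eval_ev sm) => //; first by rewrite /= sI; lia.
    by apply: leW'; rewrite /=; lia.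
  by apply: (eval_ev sm) => //; apply: leW'; rewrite ?cost_gt0 //=; lia.
- move=> /andP[wp wq] sm m8 leW.
  have leW' k F : k <= m + time (regs s 0) (PSeq p q) -> 
      F <= max_cost p + max_cost q -> (k + 2) ^ F <= W.
    move=> lek le; apply: leq_trans leW.
    apply: leq_trans (_ : (k + 2) ^ max_cost (PSeq p q) <= _).
      by rewrite leq_exp2l //; lia.
    by case: (max_cost (PSeq p q)) => // ?; rewrite leq_exp2r; lia.
  case: (IHp s m) => //; first by apply: leW' => /=; lia.
  set s1 := sem p s => sm1 [t1 le1 ex1].
  have s10 : regs s1 0 = regs s 0 by apply: sem_reg0.
  case: (IHq s1 (m + time (regs s 0) p)) => //; first lia.
    by rewrite s10; apply: leW' => /=; lia.
  rewrite s10 => sm2 [t2 le2 ex2].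
  split; first by apply: state_le_trans sm2 _; rewrite /=; lia.
  by exists (t1 + t2); [rewrite /=; lia | apply: exec_seq ex1 ex2].
- move=> /and3P[sE wp wq] sm m8 leW.
  have leW' k F : k <= m + time (regs s 0) (PIf E p q) -> 
      F <= cost E + (max_cost p + max_cost q) -> (k + 2) ^ F <= W.
    move=> lek le; apply: leq_trans leW.
    apply: leq_trans (_ : (k + 2) ^ max_cost (PIf E p q) <= _).
      by rewrite leq_exp2l //; lia.
    by case: (max_cost (PIf E p q)) => // ?; rewrite leq_exp2r; lia.
  have evE : eval W s E = Some (ev s E).
    by apply: (eval_ev sm) => //; apply: leW'; lia.
  case: (IHp s m) => //; first by apply: leW' => /=; lia.
  case: (IHq s m) => //; first by apply: leW' => /=; lia.
  move=> smq [tq leq exq] smp [tp lep exp].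
  case vE: (ev s E != 0); rewrite /= vE.
    split; first by apply: state_le_trans smp _; lia.
    exists ((cost E).+1 + tp); first lia.
    by apply: exec_if evE _; rewrite vE.
  split; first by apply: state_le_trans smq _; lia.
  exists ((cost E).+1 + tq); first lia.
  by apply: exec_if evE _; rewrite vE.
move=> wfx sm m8; set n := regs s 0; set T := time n p.
case/and3P: (wfx) => x0 xp wp leW.
have leW' k F : k <= m + time n (PFor x p) -> 
    F <= 3 + max_cost p -> (k + 2) ^ F <= W.
  move=> lek le; apply: leq_trans leW.
  apply: leq_trans (_ : (k + 2) ^ max_cost (PFor x p) <= _).
    by rewrite leq_exp2l //; lia.
  by case: (max_cost (PFor x p)) => // ?; rewrite leq_exp2r; rewrite -/n; lia.
pose step s' := set_reg (sem p s') x (regs (sem p s') x).+1.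
(* [k] counts the rounds still to come; the value bound has already paid for the other n - k. *)
have loop k : k <= n -> forall s', regs s' 0 = n -> regs s' x = n - k ->
    state_le s' (m + (n - k) * (T + 8)) ->
    state_le (iter k step s') (m + n * (T + 8)) /\
    exists2 t, t <= 4 + k * (T + 8) & exec W (While (loop_test x)
      (Seq (compile p) (Assign x (succ_reg x)))) s' t (iter k step s').
  elim: k => [_|k IHk lt] s' r0 rx sm'.
    split; first by move: sm'; rewrite subn0.
    exists 4 => //; apply: exec_while_end.
    rewrite (eval_ev (m := m + (n - 0) * (T + 8))) //=; first by rewrite r0 rx subn0 ltnn.
      lia.
    by apply: leW' => //=; rewrite subn0 -/T; nia.
  have kT : (n - k.+1) * (T + 8) + (T + 8) + k * (T + 8) = n * (T + 8).
    have -> : n * (T + 8) = (n - k.+1 + 1 + k) * (T + 8) by congr (_ * _); lia.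
    by rewrite 2!mulnDl mul1n.
  have kT' : (n - k) * (T + 8) = (n - k.+1) * (T + 8) + (T + 8).
    have -> : n - k = n - k.+1 + 1 by lia.
    by rewrite mulnDl mul1n.
  case: (IHp s' (m + (n - k.+1) * (T + 8))) => //; first lia.
    by rewrite r0 -/T; apply: leW' => /=; rewrite -/T; lia.
  rewrite r0 -/T => smp [t1 let1 ex1].
  have rp0 : regs (sem p s') 0 = n by rewrite sem_reg0.
  have rpx : regs (sem p s') x = n - k.+1 by rewrite sem_reg.
  have st0 : regs (step s') 0 = n.
    by rewrite /step /= /update eq_sym (negbTE x0).
  have stx : regs (step s') x = n - k.
    by rewrite /step /= /update eqxx rpx; lia.
  have sms : state_le (step s') (m + (n - k) * (T + 8)).
    apply: state_le_set_reg; first by apply: state_le_trans smp _; lia.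
    by have := smp.1 x; lia.
  case: (IHk (ltnW lt) _ st0 stx sms) => le' [t2 let2 ex2].
  rewrite iterSr; split=> //.
  exists (4 + (t1 + 4) + t2); first lia.
  apply: (exec_while_step (v := 1) (s1 := step s')) ex2 => //.
    rewrite (eval_ev (m := m + (n - k.+1) * (T + 8))) //=; first by rewrite r0 rx; congr Some; lia.
      lia.
    by apply: leW' => //=; rewrite -/T; lia.
  apply: exec_seq ex1 _.
  have -> : step s' = set_reg (sem p s') x (ev (sem p s') (succ_reg x)).
    by rewrite /= addn1.
  apply: exec_assign; apply: (eval_ev smp) => //; first lia.
  by apply: leW' => //=; rewrite -/T; lia.
have sm0 : state_le (set_reg s x 0) (m + (n - n) * (T + 8)).
  by apply: state_le_set_reg => //; apply: state_le_trans sm _; lia.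
case: (loop n (leqnn n) (set_reg s x 0)) => //.
- by rewrite /= /update eq_sym (negbTE x0).
- by rewrite /= /update eqxx subnn.
move=> le' [t let_ ex]; split; first by apply: state_le_trans le' _; rewrite /= -/T; lia.
exists (2 + t); first by rewrite /= -/T; lia.
apply: exec_seq ex; apply: exec_assign.
rewrite (eval_ev sm) //=.
by apply: leW' => /=; lia.
Qed.

Fixpoint depth (p : prog) : nat :=
  match p with
  | PSeq p q | PIf _ p q => maxn (depth p) (depth q)
  | PFor _ p => (depth p).+1
  | _ => 0
  end.

(** The base n + 1 keeps powers monotone in the exponent even for n = 0. *)
Lemma time_le_depth p : exists K, forall n, time n p <= K * n.+1 ^ depth p.
Proof.
have mono K n a b : a <= b -> K * n.+1 ^ a <= K * n.+1 ^ b.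
  by case: n => [|n] le; rewrite ?exp1n // leq_mul2l leq_exp2l // le orbT.
have gt0 n a : 0 < n.+1 ^ a by rewrite expn_gt0.
elim: p => [|x E|j X E|p [K IHp] q [L IHq]|E p [K IHp] q [L IHq]|x p [K IHp]].
- by exists 1.
- by exists (cost E).+1 => n; rewrite expn0 muln1.
- by exists (cost (addr j X) + cost E).+1 => n; rewrite expn0 muln1.
- exists (K + L) => n; rewrite mulnDl /=; apply: leq_add.
    exact: leq_trans (IHp n) (mono _ _ _ _ (leq_maxl _ _)).
  exact: leq_trans (IHq n) (mono _ _ _ _ (leq_maxr _ _)).
- exists ((cost E).+1 + (K + L)) => n; rewrite !mulnDl /=; apply: leq_add.
    by rewrite leq_pmulr.
  apply: leq_add.
    exact: leq_trans (IHp n) (mono _ _ _ _ (leq_maxl _ _)).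
  exact: leq_trans (IHq n) (mono _ _ _ _ (leq_maxr _ _)).
exists (14 + K) => n; rewrite /= expnS.
by have := IHp n; have := gt0 n (depth p); nia.
Qed.

Lemma leq_poly_expn K d : exists k, forall n, K * n.+1 ^ d <= (n + 2) ^ k.
Proof.
exists (K + d) => n; rewrite expnD leq_mul //.
  by apply: leq_trans (ltnW (ltn_expl K (ltnSn 1))) _; case: K => // K; rewrite leq_exp2r //; lia.
by case: d => // d; rewrite leq_exp2r //; lia.
Qed.

(* A stored value grows by at most 1 per time unit, so a polynomial running
   time keeps all values, and hence all addresses, polynomially small. *)
Lemma solvable_by_prog (C Q : forall n, rel 'I_n -> Prop) (p : prog) (x : nat) :
    wf p ->
    (forall n (e : rel 'I_n), simple_graph e -> C n e ->
       (regs (sem p (input e)) x <> 0 <-> Q n e)) ->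
  solvable_in_time C Q (fun n => n ^ depth p).
Proof.
move=> wfp correct.
have [K timeK] := time_le_depth p.
(* The 11 and the extra power of n + 1 absorb the summand n + 10 that joins the running time in
   [leW]. *)
have [k0 le_k0] := leq_poly_expn (K + 11) (depth p).+1.
pose k := k0 * (max_cost p).+1.
exists (Seq (compile p) (Assign 0 (Reg x))), k, (fun n => time n p + 2); split.
  (* The threshold 1 is there because n + 1 is at most 2n only for positive n. *)
  exists ((K + 2) * 2 ^ depth p), 1 => n n1.
  have le : n.+1 ^ depth p <= 2 ^ depth p * n ^ depth p.
    by rewrite -expnMn; case: (depth p) => // d; rewrite leq_exp2r //; lia.
  have gt0 : 0 < n.+1 ^ depth p by rewrite expn_gt0.
  apply: leq_trans (_ : (K + 2) * n.+1 ^ depth p <= _).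
    by rewrite mulnDl leq_add //; lia.
  by rewrite -mulnA leq_mul2l le orbT.
move=> n e simple_e Ce.
have sm : state_le (input e) (n + 8).
  split=> [y|a] /=; first by case: eqP; lia.
  by rewrite /adj_mem; case: [exists _, _]; lia.
have leW : (n + 8 + time n p + 2) <= (n + 2) ^ k0.
  apply: leq_trans (le_k0 n).
  have gt0 : 0 < n.+1 ^ depth p by rewrite expn_gt0.
  by have := timeK n; rewrite expnS; nia.
have leW' j : j <= (max_cost p).+1 -> (n + 8 + time n p + 2) ^ j <= (n + 2) ^ k.
  case: j => [|j] le; first by rewrite expn0 expn_gt0 addn2.
  apply: leq_trans (_ : ((n + 2) ^ k0) ^ j.+1 <= _); first by rewrite leq_exp2r.
  by rewrite -expnM leq_exp2l ?leq_mul2l ?le ?orbT //; lia.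
have [|le' [t let_ ex]] := exec_sem (W := (n + 2) ^ k) wfp sm (leq_addl _ _).
  exact: leW'.
exists (t + 2), (set_reg (sem p (input e)) 0 (regs (sem p (input e)) x)).
split; last by rewrite /= /update eqxx; apply: correct.
  apply: exec_seq ex _; apply: exec_assign.
  by apply: (eval_ev le') => //=; [lia | exact: leW'].
by move: let_ => /=; lia.
Qed.

(** * Arrays, frames and the loop rule *)

Definition arr (s : state) (j i : nat) : nat :=
  mem s (regs s 0 * regs s 0 + 8 * i + j).

Definition put (s : state) (j i v : nat) : state :=
  set_mem s (regs s 0 * regs s 0 + 8 * i + j) v.

Arguments arr : simpl never.

Lemma arr_put s j i v j' i' : j < 8 -> j' < 8 ->
  arr (put s j i v) j' i' = if (j' == j) && (i' == i) then v else arr s j' i'.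
Proof.
move=> j8 j8'; rewrite /arr /= /update; congr (if _ then _ else _).
by apply/eqP/andP => [h|[/eqP-> /eqP->]] //; split; apply/eqP; lia.
Qed.

Lemma arr_set_reg s x v j i : x != 0 -> arr (set_reg s x v) j i = arr s j i.
Proof. by move=> x0; rewrite /arr /= /update eq_sym (negbTE x0). Qed.

Lemma ev_Const s v : ev s (Const v) = v. Proof. by []. Qed.
Lemma ev_Reg s x : ev s (Reg x) = regs s x. Proof. by []. Qed.
Lemma ev_Op s o E F : ev s (Op o E F) = apply_op o (ev s E) (ev s F).
Proof. by []. Qed.
Lemma ev_Cell s j X : ev s (Cell j X) = arr s j (ev s X). Proof. by []. Qed.
Definition evE := (ev_Const, ev_Reg, ev_Op, ev_Cell).

Lemma sem_PSkip s : sem PSkip s = s. Proof. by []. Qed.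
Lemma sem_PSet x E s : sem (PSet x E) s = set_reg s x (ev s E).
Proof. by []. Qed.
Lemma sem_PPut j X E s : sem (PPut j X E) s = put s j (ev s X) (ev s E).
Proof. by []. Qed.
Lemma sem_PSeq p q s : sem (PSeq p q) s = sem q (sem p s). Proof. by []. Qed.
Lemma sem_PIf E p q s :
  sem (PIf E p q) s = if ev s E != 0 then sem p s else sem q s.
Proof. by []. Qed.
Definition semE := (sem_PSkip, sem_PSet, sem_PPut, sem_PSeq, sem_PIf).

Record frame (p : prog) (s s' : state) : Prop := Frame {
  frame_reg : forall x, ~~ assigns x p -> regs s' x = regs s x;
  frame_arr : forall j i, j < 8 -> ~~ writes j p -> arr s' j i = arr s j i;
  frame_low : forall a, a < regs s 0 * regs s 0 -> mem s' a = mem s a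
}.

Lemma frame_refl p s : frame p s s.
Proof. by []. Qed.

Lemma frame_set_reg p s s' x v : x != 0 -> assigns x p ->
  frame p s s' -> frame p s (set_reg s' x v).
Proof.
move=> x0 px [fr fa fl]; split=> // [y py|j i j8 pj].
  by rewrite /= /update; case: eqP => [yx|_]; [rewrite yx px in py | apply: fr].
by rewrite arr_set_reg // fa.
Qed.

Lemma frame_trans p q s s1 s2 : wf p ->
  (forall x, assigns x q -> assigns x p) ->
  (forall j, writes j q -> writes j p) ->
  frame p s s1 -> frame q s1 s2 -> frame p s s2.
Proof.
move=> wp qp wqp [fr1 fa1 fl1] [fr2 fa2 fl2].
have r0 : regs s1 0 = regs s 0 by apply: fr1; apply: wf_assigns0.
split=> [x px|j i j8 pj|a a_lt].
- by rewrite fr2 ?fr1 //; apply: contra px; apply: qp.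
- by rewrite fa2 ?fa1 //; apply: contra pj; apply: wqp.
- by rewrite fl2 ?r0 // fl1.
Qed.

Lemma sem_frame p s : wf p -> frame p s (sem p s).
Proof.
elim: p s => [|x E|j X E|p IHp q IHq|E p IHp q IHq|x p IHp] s wfp.
- exact: frame_refl.
- case/and3P: (wfp) => x0 _ _.
  by apply: frame_set_reg (frame_refl _ _); rewrite /= ?eqxx.
- case/and4P: wfp => j8 _ _ _; rewrite sem_PPut; split=> // [k i k8 /= /negbTE kj|a a_lt].
    by rewrite arr_put // kj.
  by rewrite /= /update; case: eqP => // a_eq; lia.
- case/andP: (wfp) => wp wq.
  apply: (@frame_trans _ q _ (sem p s)) => //; last exact: IHq.
  - by move=> x /= ->; rewrite orbT.
  - by move=> x /= ->; rewrite orbT.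
  apply: (@frame_trans _ p _ s) => //; last exact: IHp.
  - by move=> x /= ->.
  - by move=> x /= ->.
- case/and3P: (wfp) => _ wp wq.
  rewrite sem_PIf; case: ifP => _.
    apply: (@frame_trans _ p _ s) => //; last exact: IHp.
    - by move=> x /= ->.
    - by move=> x /= ->.
  apply: (@frame_trans _ q _ s) => //; last exact: IHq.
  - by move=> x /= ->; rewrite orbT.
  - by move=> x /= ->; rewrite orbT.
case/and3P: (wfp) => x0 xp wp /=.
have assx : assigns x (PFor x p) by rewrite /= eqxx.
elim: (regs s 0) => [|k IHk] /=; first exact: frame_set_reg (frame_refl _ _).
apply: frame_set_reg => //; apply: frame_trans IHk (IHp _ wp) => //.
by move=> y /= ->; rewrite orbT.
Qed.

(** The frame hands the body everything that the loop leaves untouched, so [Inv] has to describe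
    only what changes. Stability under writes to [x] lets the loop advance its counter. *)
Lemma sem_for (n : nat) (Inv : nat -> state -> Prop) x p s :
    wf (PFor x p) -> regs s 0 = n ->
    (forall i s' v, Inv i s' -> Inv i (set_reg s' x v)) ->
    Inv 0 s ->
    (forall i s', i < n -> frame (PFor x p) s s' -> regs s' x = i -> Inv i s' ->
      Inv i.+1 (sem p s')) ->
  Inv n (sem (PFor x p) s).
Proof.
move=> wfx s0 stable inv0 invS; case/and3P: (wfx) => x0 xp wp.
have assx : assigns x (PFor x p) by rewrite /= eqxx.
rewrite /= s0; set step := fun s' => _.
suff H k : k <= n -> let s' := iter k step (set_reg s x 0) in
    [/\ frame (PFor x p) s s', regs s' x = k & Inv k s'].
  by case: (H n (leqnn n)).
elim: k => [_|k IHk lt] /=.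
  split; last exact: stable.
    exact: frame_set_reg (frame_refl _ _).
  by rewrite /update eqxx.
case: (IHk (ltnW lt)); set s' := iter _ _ _ => fr rx inv.
have rx' : regs (sem p s') x = k by rewrite sem_reg.
rewrite /step rx'; split; last by apply: stable; apply: invS.
  apply: frame_set_reg => //; apply: frame_trans fr (sem_frame _ wp) => //.
  by move=> y /= ->; rewrite orbT.
by rewrite /= /update eqxx.
Qed.

(** * Breadth-first levels from a set of dominators *)

Section Levels.

Variables (T : finType) (e : rel T).

(* Levels start at 1 on the root set; 0 marks the unreached vertices. *)
Definition level_function (R : {set T}) (lev : T -> nat) : Prop :=
  [/\ forall v, (lev v == 1) = (v \in R),
      forall u v, e u v -> 0 < lev u -> 0 < lev v <= (lev u).+1
    & forall v, 1 < lev v -> exists2 u, e u v & (lev u).+1 = lev v].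

(* [w] hangs at the center of an induced path u1 v1 w v2 u2 leading away from
   the roots, where [v1] is the dominator of [w] and [v2] competes with it. *)
Record fork (D : {set T}) (lev : T -> nat) (w v1 v2 u1 u2 : T) : Prop := Fork {
  fork_w : 0 < lev w;
  fork_D1 : v1 \in D;
  fork_D2 : u2 \in D;
  fork_wv1 : e w v1;
  fork_wv2 : e w v2;
  fork_vu1 : e v1 u1;
  fork_vu2 : e v2 u2;
  fork_vu21 : e v2 u1 = false;
  fork_lv1 : lev v1 = (lev w).+1;
  fork_lv2 : lev v2 = (lev w).+1;
  fork_lu1 : lev w < lev u1;
  fork_lu2 : lev w < lev u2
}.

(** The conditions of [level_function] determine the values (distance to [R] plus one), so
    quantifying over [lev] amounts to naming that one function. *)
Definition unambiguous (D R : {set T}) : Prop :=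
  forall lev w v1 v2 u1 u2, level_function R lev -> ~ fork D lev w v1 v2 u1 u2.

Lemma ambiguousP (D R : {set T}) : ~ unambiguous D R ->
  exists lev w v1 v2 u1 u2, level_function R lev /\ fork D lev w v1 v2 u1 u2.
Proof.
move=> amb; apply: NNPP => none; apply: amb => lev w v1 v2 u1 u2 lf fk.
by apply: none; exists lev, w, v1, v2, u1, u2.
Qed.

Hypotheses (sym_e : symmetric e) (irr_e : irreflexive e).

Lemma eds_uniq D v a b : efficient_dominating_set e D ->
  a \in D -> b \in D -> (a == v) || e v a -> (b == v) || e v b -> a = b.
Proof.
move=> edsD aD bD va vb.
have /eqP/cards1P[z Nz] := edsD v.
have /set1P-> : a \in [set z] by rewrite -Nz !inE va.
by have /set1P-> : b \in [set z] by rewrite -Nz !inE vb.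
Qed.

Lemma eds_adj D v a b : efficient_dominating_set e D ->
  a \in D -> b \in D -> e v a -> e v b -> a = b.
Proof. by move=> edsD aD bD va vb; apply: (eds_uniq edsD aD bD (v := v)); rewrite ?va ?vb orbT. Qed.

Lemma eds_indep D a b : efficient_dominating_set e D ->
  a \in D -> b \in D -> e a b = false.
Proof.
move=> edsD aD bD; apply/negP => ab.
suff ba : b = a by rewrite ba irr_e in ab.
by apply: (eds_uniq edsD bD aD (v := a)); rewrite ?ab ?eqxx ?orbT.
Qed.

Hypothesis spider_free : induced_free (spider 2 2 4) e.
Variable A : {set T}.
Hypothesis color : forall x y, e x y -> (x \in A) != (y \in A).

Lemma same_color x y : (x \in A) = (y \in A) -> e x y = false.
Proof. by move=> xy; apply/negP => /color; rewrite xy eqxx. Qed.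

Lemma color_adj x y : e x y -> (y \in A) = ~~ (x \in A).
Proof. by move/color; case: (x \in A); case: (y \in A). Qed.

(** Only pairs of opposite colour appear among the non-edges; the colouring settles the others. *)
Lemma no_spider w v1 u1 v2 u2 p1 p2 p3 p4 :
    e w v1 -> e v1 u1 -> e w v2 -> e v2 u2 ->
    e w p1 -> e p1 p2 -> e p2 p3 -> e p3 p4 ->
    e v1 u2 = false -> e v2 u1 = false ->
    e v1 p2 = false -> e v1 p4 = false -> e v2 p2 = false -> e v2 p4 = false ->
    e u1 p1 = false -> e u1 p3 = false -> e u2 p1 = false -> e u2 p3 = false ->
    e w p3 = false -> e p1 p4 = false ->
  False.
Proof.
move=> wv1 vu1 wv2 vu2 wp1 p12 p23 p34.
move=> v1u2 v2u1 v1p2 v1p4 v2p2 v2p4 u1p1 u1p3 u2p1 u2p3 wp3 p14.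
have cv1 := color_adj wv1; have cv2 := color_adj wv2; have cp1 := color_adj wp1.
have cu1 := color_adj vu1; have cu2 := color_adj vu2; have cp2 := color_adj p12.
have cp3 := color_adj p23; have cp4 := color_adj p34.
move: cu1 cu2 cp2 cp3 cp4; rewrite cp1 cv1 cv2 negbK => cu1 cu2 cp2.
rewrite cp2 => cp3; rewrite cp3 negbK => cp4.
have sc x y : (x \in A) = (y \in A) -> e x y = false := @same_color x y.
have wu1 := sc w u1 (esym cu1); have wu2 := sc w u2 (esym cu2).
have wp2 := sc w p2 (esym cp2); have wp4 := sc w p4 (esym cp4).
have v12 : e v1 v2 = false by apply: sc; rewrite cv1 cv2.
have v1p1 : e v1 p1 = false by apply: sc; rewrite cv1 cp1.
have v1p3 : e v1 p3 = false by apply: sc; rewrite cv1 cp3.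
have v2p1 : e v2 p1 = false by apply: sc; rewrite cv2 cp1.
have v2p3 : e v2 p3 = false by apply: sc; rewrite cv2 cp3.
have u12 : e u1 u2 = false by apply: sc; rewrite cu1 cu2.
have u1p2 : e u1 p2 = false by apply: sc; rewrite cu1 cp2.
have u1p4 : e u1 p4 = false by apply: sc; rewrite cu1 cp4.
have u2p2 : e u2 p2 = false by apply: sc; rewrite cu2 cp2.
have u2p4 : e u2 p4 = false by apply: sc; rewrite cu2 cp4.
have p13 : e p1 p3 = false by apply: sc; rewrite cp1 cp3.
have p24 : e p2 p4 = false by apply: sc; rewrite cp2 cp4.
clear sc cv1 cv2 cp1 cu1 cu2 cp2 cp3 cp4.
pose f (x : spider_vertex 2 2 4) : T :=
  match x with
  | None => w
  | Some (inl (inl i)) => nth w [:: v1; u1] i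
  | Some (inl (inr i)) => nth w [:: v2; u2] i
  | Some (inr i) => nth w [:: p1; p2; p3; p4] i
  end.
have fE x y : e (f x) (f y) = spider 2 2 4 x y.
  case: x => [[[[[|[|x]] hx]|[[|[|x]] hx]]|[[|[|[|[|x]]]] hx]]|] //;
  case: y => [[[[[|[|y]] hy]|[[|[|y]] hy]]|[[|[|[|[|y]]]] hy]]|] //;
  rewrite /spider /=; first [exact: irr_e | done | by rewrite sym_e].
apply: spider_free; exists f; split=> // x y fxy.
(* Injectivity comes for free: no two vertices of S_{2,2,4} have the same neighbours, so adjacency
   alone separates the images. *)
have twins z : spider 2 2 4 x z = spider 2 2 4 y z by rewrite -!fE fxy.
pose x_ k : spider_vertex 2 2 4 := Some (inl (inl (inord k))).
pose y_ k : spider_vertex 2 2 4 := Some (inl (inr (inord k))).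
pose z_ k : spider_vertex 2 2 4 := Some (inr (inord k)).
move: (twins None) (twins (x_ 0)) (twins (x_ 1)) (twins (y_ 0)) (twins (y_ 1))
  (twins (z_ 0)) (twins (z_ 1)) (twins (z_ 2)) (twins (z_ 3)).
rewrite /x_ /y_ /z_ /spider /=.
clear -x y.
case: x => [[[[[|[|x]] hx]|[[|[|x]] hx]]|[[|[|[|[|x]]]] hx]]|] //;
case: y => [[[[[|[|y]] hy]|[[|[|y]] hy]]|[[|[|[|[|y]]]] hy]]|] //=;
  rewrite /= ?inordK //= => *;
  first [discriminate | by congr (Some (inl (inl _))); apply: val_inj
      | by congr (Some (inl (inr _))); apply: val_inj
      | by congr (Some (inr _)); apply: val_inj].
Qed.

(* [lia] splits on boolean atoms, so adjacency hypotheses are dropped first. *)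
Ltac lev_lia :=
  repeat match goal with
  | H : is_true (e _ _) |- _ => clear H
  | H : e _ _ = _ |- _ => clear H
  | H : is_true (_ \in _) |- _ => clear H
  end; lia.

(** * Where forks can occur *)

Section Forks.

Variables (D R : {set T}) (lev : T -> nat).
Hypotheses (edsD : efficient_dominating_set e D) (lf : level_function R lev).

Lemma level_gt0 u v : e u v -> 0 < lev u -> 0 < lev v.
Proof. by case: lf => _ step _ uv /(step _ _ uv)/andP[]. Qed.

Lemma level_far u v : 0 < lev u -> (lev u).+1 < lev v -> e u v = false.
Proof.
case: lf => _ step _ u0 uv; apply/negP => /step/(_ u0).
by case/andP=> _; rewrite leqNgt uv.
Qed.

Lemma level_root r : r \in R -> lev r = 1.
Proof. by case: lf => root _ _; rewrite -root => /eqP. Qed.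

Lemma level_nbr r b : r \in R -> e r b -> 0 < lev b <= 2.
Proof. by case: lf => _ step _ /level_root r1 /step; rewrite r1 => ->. Qed.

Variables w v1 v2 u1 u2 : T.
Hypothesis fk : fork D lev w v1 v2 u1 u2.

(** The leg lies strictly below the level of [w] and the four outer vertices of the fork strictly
    above it. The levels thus differ by at least two, which rules out every edge between them. *)
Lemma fork_no_leg p1 p2 p3 p4 :
    e w p1 -> e p1 p2 -> e p2 p3 -> e p3 p4 ->
    lev p1 < lev w -> lev p2 < lev w -> lev p3 < lev w -> lev p4 < lev w ->
    e w p3 = false -> e p1 p4 = false ->
  False.
Proof.
case: fk => w0 D1 D2 wv1 wv2 vu1 vu2 vu21 lv1 lv2 lu1 lu2.
move=> wp1 p12 p23 p34 l1 l2 l3 l4 wp3 p14.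
have p10 := level_gt0 wp1 w0; have p20 := level_gt0 p12 p10.
have p30 := level_gt0 p23 p20; have p40 := level_gt0 p34 p30.
have v1u2 : e v1 u2 = false by apply: (eds_indep edsD).
have far x y : 0 < lev x -> (lev x).+1 < lev y -> e y x = false.
  by move=> x0 xy; rewrite sym_e level_far.
refine (no_spider wv1 vu1 wv2 vu2 wp1 p12 p23 p34 v1u2 vu21 _ _ _ _ _ _ _ _ wp3 p14);
  by apply: far => //; lev_lia.
Qed.

(** From level 5 on, four successive parents form the leg. *)
Lemma fork_level_le4 : lev w <= 4.
Proof.
rewrite leqNgt; apply/negP => w4.
have [_ _ par] := lf.
have [p1 p1w l1] := par w (ltn_trans (isT : 1 < 4) w4).
have [|p2 p21 l2] := par p1; first lev_lia.
have [|p3 p32 l3] := par p2; first lev_lia.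
have [|p4 p43 l4] := par p3; first lev_lia.
apply: (@fork_no_leg p1 p2 p3 p4); rewrite 1?sym_e //; try lev_lia.
  by rewrite level_far //; lev_lia.
by rewrite level_far //; lev_lia.
Qed.

(** On levels 1 and 2 a root dominates [w], hence equals [v1]; but [v1] lies further out than
    [w]. *)
Lemma fork_level_gt2 : R \subset D -> 2 < lev w.
Proof.
have [root step par] := lf.
case: fk => w0 D1 D2 wv1 wv2 vu1 vu2 vu21 lv1 lv2 lu1 lu2 /subsetP RD.
have noroot r : r \in R -> (w == r) || e w r -> False.
  move=> rR wr; have rv1 : r = v1.
    by apply: (eds_uniq edsD (RD _ rR) D1 (v := w)); rewrite ?wv1 ?orbT // eq_sym.
  by have := level_root rR; rewrite rv1 lv1; lev_lia.
rewrite ltn_neqAle; apply/andP; split; last first.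
  rewrite ltn_neqAle w0 andbT eq_sym root; apply/negP => wR.
  by apply: (noroot w); rewrite ?eqxx.
rewrite eq_sym; apply/negP => /eqP w2.
have [|r rw] := par w; first by rewrite w2.
by rewrite w2 => -[/eqP]; rewrite root => rR; apply: (noroot r rR); rewrite sym_e rw orbT.
Qed.

Section Partner.

Variables r b c r' : T.
Hypotheses (rR : r \in R) (rR' : r' \in R).
Hypotheses (rb : e r b) (bc : e b c) (cr' : e c r').

(** The leg is p1, b, c, r' if [p1] is adjacent to [b], and p1, p2, r, b otherwise. *)
Lemma fork_level4_parent p1 p2 :
  lev w = 4 -> e w p1 -> e p1 p2 -> e p2 r -> lev p1 = 3 -> lev p2 = 2 -> False.
Proof.
move=> w4 wp1 p12 p2r l1 l2.
have lr := level_root rR; have lr' := level_root rR'.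
have /andP[b0 lb] := level_nbr rR rb.
have /andP[c0 lc] : 0 < lev c <= 2 by apply: (level_nbr rR'); rewrite sym_e.
case p1b: (e p1 b).
  apply: (@fork_no_leg p1 b c r'); rewrite ?p1b //; try lev_lia.
    by rewrite sym_e level_far //; lev_lia.
  by rewrite sym_e level_far //; lev_lia.
apply: (@fork_no_leg p1 p2 r b); rewrite ?p1b //; try lev_lia.
by rewrite sym_e level_far //; lev_lia.
Qed.

(** The witness is [p] if it is adjacent to [c], and otherwise [b], because p, r, b, c would be a
    leg if [w] missed [b]. A neighbour f of r' missed by the witness q would give the leg q, c, r',
    f. *)
Lemma fork_level3_parent p : lev w = 3 -> e w p -> e r p ->
  exists q, [/\ e w q, e r q & forall f, e r' f -> e q f].
Proof.
move=> w3.
have lr := level_root rR; have lr' := level_root rR'.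
have /andP[b0 lb] := level_nbr rR rb.
have /andP[c0 lc] : 0 < lev c <= 2 by apply: (level_nbr rR'); rewrite sym_e.
have complete q : e w q -> e r q -> e q c -> forall f, e r' f -> e q f.
  move=> wq rq qc f r'f; apply/negPn/negP => /negbTE qf.
  have /andP[q0 lq] := level_nbr rR rq.
  have /andP[f0 lf'] := level_nbr rR' r'f.
  apply: (@fork_no_leg q c r' f) => //; try lev_lia.
  by rewrite sym_e level_far //; lev_lia.
move=> wp rp; case pc: (e p c); first by exists p; split=> //; apply: complete.
case wb: (e w b); first by exists b; split=> //; apply: complete.
have /andP[p0 lp] := level_nbr rR rp.
by case: (@fork_no_leg p r b c) => //; rewrite 1?sym_e //; lev_lia.
Qed.

End Partner.

(** For roots in an e.d.s. of a bipartite graph this is distance exactly 3: the ends have different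
    colours and members of the e.d.s. are not adjacent. *)
Definition paired : Prop := forall r, r \in R ->
  exists b c r', [/\ r' \in R, e r b, e b c & e c r'].

Lemma fork_level3 : R \subset D -> paired -> lev w = 3.
Proof.
move=> RD pairR; have w2 := fork_level_gt2 RD; have w4 := fork_level_le4.
apply/eqP; rewrite eqn_leq w2 andbT leqNgt; apply/negP => w3.
have {w3} w4' : lev w = 4 by lev_lia.
have [root step par] := lf.
have [|p1 p1w l1] := par w; first lev_lia.
have [|p2 p21 l2] := par p1; first lev_lia.
have [|r rp2 lr] := par p2; first lev_lia.
have rR : r \in R by rewrite -root; apply/eqP; lev_lia.
have [b [c [r' [rR' rb bc cr']]]] := pairR r rR.
by apply: (fork_level4_parent rR rR' rb bc cr' w4' (p1 := p1) (p2 := p2));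
  rewrite 1?sym_e //; lev_lia.
Qed.

Lemma fork_parent : R \subset D -> paired ->
  exists r p, [/\ r \in R, e r p & e w p].
Proof.
move=> RD pairR; have w3 := fork_level3 RD pairR.
have [root step par] := lf.
have [|p pw lp] := par w; first lev_lia.
have [|r rp lr] := par p; first lev_lia.
by exists r, p; split=> //; [rewrite -root; apply/eqP; lev_lia | rewrite sym_e].
Qed.

End Forks.

(** Neighbours of roots have level at most 2, and [u1] has level at least 4. This is what later
    contradicts the completeness given by [fork_level3_parent]. *)
Lemma fork_nonadj (D R : {set T}) lev w v1 v2 u1 u2 r p :
    level_function R lev -> fork D lev w v1 v2 u1 u2 -> lev w = 3 ->
  r \in R -> e r p -> e p u1 = false.
Proof.
move=> lf fk w3 rR rp; have /andP[p0 lp] := level_nbr lf rR rp.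
by rewrite (level_far lf) //; have := fork_lu1 fk; lev_lia.
Qed.

Lemma fork_notroot (D R : {set T}) lev w v1 v2 u1 u2 r :
  level_function R lev -> fork D lev w v1 v2 u1 u2 -> r \in R -> (r == v1) = false.
Proof.
move=> lf fk rR; apply/negP => /eqP rv; have := level_root lf rR.
by rewrite rv (fork_lv1 fk); have := fork_w fk; lev_lia.
Qed.

(** * From one root to at most four *)

Section Chain.

Variable D : {set T}.
Hypothesis edsD : efficient_dominating_set e D.

Let adjD v a b : a \in D -> b \in D -> (a == b) = false -> e v a -> e v b = false.
Proof.
move=> aD bD ab va; apply/negP => vb.
by rewrite (eds_adj edsD aD bD va vb) eqxx in ab.
Qed.

(* A fork over these four roots has a parent next to one of them.  Next to al,
   be or ga, that parent would have to be complete to the neighbourhood of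
   another root, which z and u forbid; next to ep it extends to a spider along
   the path c, b, al. *)
Lemma unambiguous_chain al be ga ep b c x z w u :
    al \in D -> be \in D -> ga \in D -> ep \in D ->
    (al == ep) = false ->
    e al b -> e b c -> e c be -> e b x -> e x ga -> e x w -> e c w -> e w ep ->
    e ga z -> (forall p, e al p -> e p z = false) ->
    e ep u -> (forall p, e be p -> e p u = false) ->
    (forall p, e ga p -> e p u = false) ->
  unambiguous D [set al; be; ga; ep].
Proof.
move=> alD beD gaD epD alep alb bc cbe bx xga xw cw wep gaz alz epu beu gau.
move=> lev w' v1 v2 u1 u2 lf fk; set R := [set al; be; ga; ep] in lf.
have alR : al \in R by rewrite !inE eqxx.
have beR : be \in R by rewrite !inE eqxx ?orbT.
have gaR : ga \in R by rewrite !inE eqxx ?orbT.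
have epR : ep \in R by rewrite !inE eqxx ?orbT.
have RD : R \subset D by apply/subsetP => y; rewrite !inE => /orP[/orP[/orP[]|]|] /eqP->.
have S := sym_e.
have bec : e be c by rewrite S.
have gax : e ga x by rewrite S.
have epw : e ep w by rewrite S.
have wc : e w c by rewrite S.
have pairR : paired R.
  move=> r; rewrite !inE => /orP[/orP[/orP[]|]|] /eqP->.
  - by exists b, c, be.
  - by exists c, b, al; rewrite S cbe S bc S alb.
  - by exists x, b, al; rewrite S xga S bx S alb.
  - by exists w, x, ga; rewrite S wep S xw.
have w3 := fork_level3 edsD lf fk RD pairR.
have noal p : e al p -> e w' p -> False.
  move=> alp wp.
  have [q [_ alq /(_ z gaz)]] :=
    fork_level3_parent edsD lf fk alR gaR alb bx xga w3 wp alp.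
  by rewrite alz.
have [r [p [rR rp wp]]] := fork_parent edsD lf fk RD pairR.
move: rR rp; rewrite !inE => /orP[/orP[/orP[]|]|] /eqP-> rp.
- exact: noal rp wp.
- have [q [_ beq /(_ u epu)]] :=
    fork_level3_parent edsD lf fk beR epR bec cw wep w3 wp rp.
  by rewrite beu.
- have [q [_ gaq /(_ u epu)]] :=
    fork_level3_parent edsD lf fk gaR epR gax xw wep w3 wp rp.
  by rewrite gau.
have [q [wq epq /(_ c bec) qc]] :=
  fork_level3_parent edsD lf fk epR beR epw wc cbe w3 wp rp.
have /andP[_ lq] := level_nbr lf epR epq.
have /andP[_ lb] := level_nbr lf alR alb.
have /andP[_ lc] : 0 < lev c <= 2 by apply: (level_nbr lf beR); rewrite S.
apply: (fork_no_leg edsD lf fk wq qc (p3 := b) (p4 := al)); rewrite 1?S //; try lev_lia.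
- by rewrite (level_root lf alR); lev_lia.
- by apply/negP => bw; apply: (noal b); rewrite // S.
by rewrite S; apply: (adjD epD alD _ _); rewrite 1?S // eq_sym.
Qed.

(** The dominator [ga] of the given fork becomes the third root. If a fork remains, its center w
    turns out to be adjacent to both [x] and [c], and with its dominator ep as fourth root this is
    the configuration of [unambiguous_chain]. *)
Lemma unambiguous_pair al be b0 c lev x ga y2 z z2 p v :
    al \in D -> be \in D -> e al b0 -> e b0 c -> e c be ->
    level_function [set al; be] lev -> fork D lev x ga y2 z z2 ->
    e al p -> e x p -> connect e al v ->
  exists a b' c' d', [/\ [/\ a \in D, b' \in D, c' \in D & d' \in D],
    connect e a v & unambiguous D [set a; b'; c'; d']].
Proof.
move=> alD beD alb0 b0c cbe lf fk alp xp alv.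
have S := sym_e; set R := [set al; be] in lf.
have alR : al \in R by rewrite !inE eqxx.
have beR : be \in R by rewrite !inE eqxx ?orbT.
have RD : R \subset D by apply/subsetP => y; rewrite !inE => /orP[] /eqP->.
have pairR : paired R.
  move=> r; rewrite !inE => /orP[] /eqP->; first by exists b0, c, be.
  by exists c, b0, al; rewrite S cbe S b0c S alb0.
have x3 := fork_level3 edsD lf fk RD pairR.
have [b [xb alb bbe]] :=
  fork_level3_parent edsD lf fk alR beR alb0 b0c cbe x3 xp alp.
have bc : e b c by apply: bbe; rewrite S.
have bx : e b x by rewrite S.
have gaD := fork_D1 fk; have xga := fork_wv1 fk; have gaz := fork_vu1 fk.
have alz q : e al q -> e q z = false by apply: (fork_nonadj lf fk x3 alR).
have gax : e ga x by rewrite S.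
have bal : e b al by rewrite S.
have alga := fork_notroot lf fk alR; have bega := fork_notroot lf fk beR.
have [unamb|/ambiguousP] := classic (unambiguous D [set al; be; ga; ga]).
  by exists al, be, ga, ga.
move=> [lev' [w [ep [w2 [u [u2 [lf' fk']]]]]]]; set R' := [set _; _; _; _] in lf'.
have alR' : al \in R' by rewrite !inE eqxx.
have beR' : be \in R' by rewrite !inE eqxx ?orbT.
have gaR' : ga \in R' by rewrite !inE eqxx ?orbT.
have RD' : R' \subset D by apply/subsetP => y; rewrite !inE => /orP[/orP[/orP[]|]|] /eqP->.
have pairR' : paired R'.
  move=> r; rewrite !inE => /orP[/orP[/orP[]|]|] /eqP->.
  - by exists b, c, be.
  - by exists c, b, al; rewrite S cbe S bc S alb.
  - by exists x, b, al; rewrite S xga S bx S alb.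
  - by exists x, b, al; rewrite S xga S bx S alb.
have w3 := fork_level3 edsD lf' fk' RD' pairR'.
(* Completeness to the neighbourhood of [ga] would join a neighbour of [al] to [z]. *)
have noal q : e al q -> e w q -> False.
  move=> alq wq.
  have [q' [_ alq' /(_ z gaz)]] :=
    fork_level3_parent edsD lf' fk' alR' gaR' alb bx xga w3 wq alq.
  by rewrite alz.
have near r q : r \in R' -> e r q -> lev' q < lev' w.
  by move=> rR' rq; have /andP[_] := level_nbr lf' rR' rq; lev_lia.
have root r : r \in R' -> lev' r < lev' w by move/(level_root lf')->; lev_lia.
have lx : lev' x < lev' w by apply: near gaR' _; rewrite S.
have lc : lev' c < lev' w by apply: near beR' _; rewrite S.
have lb := near _ _ alR' alb.
(* Otherwise q', b, c, be is a leg, where q' is complete to the neighbourhood of [al]. *)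
have wc q : e ga q -> e w q -> e w c.
  move=> gaq wq; apply/negPn/negP => /negbTE nwc.
  have [q' [wq' gaq' /(_ b alb) qb]] :=
    fork_level3_parent edsD lf' fk' gaR' alR' gax xb bal w3 wq gaq.
  apply: (fork_no_leg edsD lf' fk' wq' qb bc cbe) => //.
  - exact: near gaR' gaq'.
  - exact: root.
  by apply: (adjD gaD beD _ _); rewrite 1?S // eq_sym.
(* Otherwise q, b, x, ga is a leg; [q] is adjacent to [b] because [b] is complete to the
   neighbourhood of [be]. *)
have wx q : e be q -> e w q -> e w x.
  move=> beq wq; apply/negPn/negP => /negbTE nwx.
  apply: (fork_no_leg edsD lf' fk' wq _ bx xga) => //.
  - by rewrite S bbe.
  - exact: near beR' beq.
  - exact: root.
  by apply: (adjD beD gaD _ _); rewrite 1?S.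
have [r [q [rR rq wq]]] := fork_parent edsD lf' fk' RD' pairR'.
(* The parent starts one of the two implications. The vertex it yields is itself next to [ga] or
   [be] and starts the other. *)
have [xw cw] : e w x /\ e w c.
  move: rR rq; rewrite !inE => /orP[/orP[/orP[]|]|] /eqP-> rq.
  - by case: (noal q).
  - have wx' := wx q rq wq; split=> //; apply: (wc x) => //; by rewrite S.
  - have wc' := wc q rq wq; split=> //; apply: (wx c) => //; by rewrite S.
  - have wc' := wc q rq wq; split=> //; apply: (wx c) => //; by rewrite S.
exists al, be, ga, ep; split=> //; first by split=> //; apply: fork_D1 fk'.
apply: (unambiguous_chain (b := b) (c := c) (x := x) (w := w) (z := z) (u := u)) => //.
- exact: fork_D1 fk'.
- exact: fork_notroot lf' fk' alR'.
- by rewrite S.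
- by rewrite S.
- exact: fork_wv1 fk'.
- exact: fork_vu1 fk'.
- by move=> q'; apply: (fork_nonadj lf' fk' w3 beR').
- by move=> q'; apply: (fork_nonadj lf' fk' w3 gaR').
Qed.

Lemma connect_level R lev v : level_function R lev -> 0 < lev v ->
  exists2 r, r \in R & connect e r v.
Proof.
move=> [root step par]; move: {2}(lev v) (leqnn (lev v)) => k.
elim: k v => [|k IHk] v le v0; first lev_lia.
case: (ltnP 1 (lev v)) => v1.
  have [u uv lu] := par v v1.
  have [||r rR ru] := IHk u; try lev_lia.
  by exists r => //; apply: connect_trans ru (connect1 uv).
by exists v; rewrite // -root; apply/eqP; lev_lia.
Qed.

(** The dominator d0 of [v] is only a first try: a fork over it exposes the path al, w, c, be
    between two members of [D], and this pair takes its place. Shorter root lists are padded by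
    repetition, and the first root stays in the component of [v]. *)
Lemma exists_unambiguous v :
  exists a b c d, [/\ [/\ a \in D, b \in D, c \in D & d \in D],
    connect e a v & unambiguous D [set a; b; c; d]].
Proof.
have S := sym_e; have csym := sym_connect_sym sym_e.
have /eqP/cards1P[d0 N0] := edsD v.
have : d0 \in closed_nbhd e v :&: D by rewrite N0 set11.
rewrite !inE => /andP[vd0 d0D].
have cd0 : connect e d0 v.
  by case/orP: vd0 => [/eqP->|vd0]; rewrite ?connect0 // connect1 // S.
have [unamb|/ambiguousP] := classic (unambiguous D [set d0; d0; d0; d0]).
  by exists d0, d0, d0, d0.
move=> [lev [w [al [c [u [be [lf fk]]]]]]].
have cw : connect e w v.
  have [r] := connect_level lf (fork_w fk).
  rewrite !inE !orbb => /eqP-> d0w.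
  by apply: connect_trans cd0; rewrite csym.
have [alD beD] := (fork_D1 fk, fork_D2 fk).
have [wal wc] := (fork_wv1 fk, fork_wv2 fk); have cbe := fork_vu2 fk.
have cal : connect e al v by apply: connect_trans cw; rewrite connect1 // S.
have cc : connect e c v by apply: connect_trans cw; rewrite connect1 // S.
have cb : connect e be v by apply: connect_trans cc; rewrite connect1 // S.
have alw : e al w by rewrite S.
have [unamb|/ambiguousP] := classic (unambiguous D [set al; be]).
  exists al, be, be, be; split=> //.
  by rewrite -!setUA !setUid.
move=> [lev' [x [ga [y2 [z [z2 [lf' fk']]]]]]].
have RD : [set al; be] \subset D by apply/subsetP => y; rewrite !inE => /orP[] /eqP->.
have pairR : paired [set al; be].
  move=> r; rewrite !inE => /orP[] /eqP->.
    by exists w, c, be; rewrite !inE eqxx orbT.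
  by exists c, w, al; rewrite S cbe S wc S alw !inE eqxx.
have [r [p [rR rp xp]]] := fork_parent edsD lf' fk' RD pairR.
move: rR rp; rewrite !inE => /orP[] /eqP-> rp.
  exact: (unambiguous_pair alD beD alw wc cbe lf' fk' rp xp cal).
rewrite setUC in lf'.
by apply: (unambiguous_pair (b0 := c) (c := w) beD alD _ _ _ lf' fk' rp xp cb); rewrite S.
Qed.

End Chain.

End Levels.

(** * Breadth-first search and greedy reconstruction *)

Section Search.

Variables (T : finType) (e : rel T).
Hypotheses (sym_e : symmetric e) (irr_e : irreflexive e).

Definition dominators (P : {set T}) (t : T) : nat := #|closed_nbhd e t :&: P|.

Lemma dominators0 t : dominators set0 t = 0.
Proof. by rewrite /dominators setI0 cards0. Qed.

Lemma dominatorsU1 (P : {set T}) v t : v \notin P ->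
  dominators (v |: P) t = dominators P t + ((t == v) || e v t).
Proof.
move=> vP; rewrite /dominators setIUr cardsU.
have -> : closed_nbhd e t :&: [set v] :&: (closed_nbhd e t :&: P) = set0.
  apply/setP => x; rewrite !inE; case: (x =P v) => [->|]; last by rewrite andbF.
  by rewrite (negbTE vP) !andbF.
rewrite cards0 subn0 addnC; congr (_ + _).
have -> : closed_nbhd e t :&: [set v] = if (t == v) || e v t then [set v] else set0.
  apply/setP => x; rewrite !inE [e v t]sym_e [t == v]eq_sym.
  case: (x =P v) => [->|xv]; first by rewrite andbT; case: ifP; rewrite !inE ?eqxx.
  by rewrite andbF; case: ifP; rewrite !inE //; move/eqP/negbTE: xv => ->.
by case: ifP; rewrite ?cards1 ?cards0.
Qed.

Lemma dominators_eq0 P t : dominators P t = 0 -> t \notin P.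
Proof.
move/eqP; rewrite cards_eq0 => /eqP/setP/(_ t); rewrite !inE eqxx /=.
by move->.
Qed.

Lemma dominators_gt0P (P : {set T}) t :
  reflect (exists2 d, d \in P & (d == t) || e t d) (0 < dominators P t).
Proof.
apply: (iffP card_gt0P) => [[d]|[d dP td]]; last by exists d; rewrite !inE td.
by rewrite !inE => /andP[td dP]; exists d.
Qed.

Lemma dominators_sub_eds (D P : {set T}) t : efficient_dominating_set e D -> P \subset D ->
  0 < dominators P t -> dominators P t = 1.
Proof.
move=> edsD PD gt0; apply/eqP; rewrite eqn_leq gt0 andbT -(edsD t).
by apply: subset_leq_card; apply: setIS.
Qed.

(** * The greedy choice of a dominator *)

Section Greedy.

Variables (D R P : {set T}) (lev : T -> nat) (w : T).
Hypotheses (edsD : efficient_dominating_set e D) (unamb : unambiguous e D R).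
Hypotheses (lf : level_function e R lev) (RP : R \subset P) (PD : P \subset D).
Hypothesis w0 : 0 < lev w.
Hypothesis done_below : forall p, 0 < lev p < lev w -> 0 < dominators P p.
Hypothesis undom_w : dominators P w = 0.

Definition candidate v := [&& e w v, dominators P v == 0 & lev v == (lev w).+1].
(** For a candidate, which lies one level above [w], this counts the neighbours beyond the level of
    [w]. Comparing with [lev v] makes it independent of [w], so one table serves a whole search. *)
Definition outdegree v := #|[set t | e v t && (lev v <= lev t)]|.

(** The parent of [d] is already dominated by a member of [P]; by uniqueness in [D] that member is
    [d]. *)
Lemma eds_low_sub d : d \in D -> 0 < lev d <= lev w -> d \in P.
Proof.
move=> dD /andP[d0 dw]; have [root step par] := lf.
case: (ltnP 1 (lev d)) => d1; last first.
  by apply: (subsetP RP); rewrite -root; apply/eqP; lia.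
have [p pd lp] := par d d1.
have /dominators_gt0P[d' dP pd'] : 0 < dominators P p by apply: done_below; lia.
rewrite (eds_uniq edsD dD (subsetP PD _ dP) (v := p)) //.
by rewrite pd orbT.
Qed.

Lemma candidate_dominator :
  exists v, [/\ v \in D, candidate v & forall v', candidate v' ->
    v' = v \/ outdegree v < outdegree v'].
Proof.
have [root step par] := lf.
have edge u v : e u v -> 0 < lev u -> 0 < lev v <= (lev u).+1 := step u v.
have gt0 t : exists2 d, d \in D & (d == t) || e t d.
  by apply/dominators_gt0P; rewrite /dominators edsD.
have [v vD vw] := gt0 w.
have undom t d : dominators P t = 0 -> (d == t) || e t d -> d \notin P.
  move=> t0 td; apply/negP => dP.
  by have : 0 < dominators P t by [apply/dominators_gt0P; exists d]; rewrite t0.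
have vP := undom _ _ undom_w vw.
have wv : e w v.
  case/orP: vw => // /eqP vw; case/negP: vP; apply: eds_low_sub => //.
  by rewrite vw w0 leqnn.
have /andP[v0 lv] := edge _ _ wv w0.
have {}lv : lev v = (lev w).+1.
  apply/eqP; rewrite eqn_leq lv ltnNge; apply: contra vP => lv'.
  by apply: eds_low_sub; rewrite ?v0.
have v_undom : dominators P v = 0.
  apply/eqP; rewrite -leqn0 leqNgt; apply/negP => /dominators_gt0P[d dP vd].
  case/negP: vP; have dD := subsetP PD _ dP.
  by rewrite (eds_uniq edsD vD dD (v := v)) // eqxx.
exists v; split=> //; first by rewrite /candidate wv v_undom lv !eqxx.
move=> v2 /and3P[wv2 /eqP v2_undom /eqP lv2].
have [vv2|vv2] := eqVneq v2 v; [by left | right].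
have [u2 u2D v2u2] := gt0 v2.
have u2P := undom _ _ v2_undom v2u2.
have {}v2u2 : e v2 u2.
  case/orP: v2u2 => // /eqP uv; rewrite uv in u2D.
  by case/eqP: vv2; apply: (eds_adj edsD u2D vD wv2 wv).
have /andP[u20 _] : 0 < lev u2 <= (lev v2).+1 by apply: edge; rewrite ?lv2.
have lu2 : lev w < lev u2.
  by rewrite ltnNge; apply: contra u2P => le; apply: eds_low_sub; rewrite ?u20.
have vu2 : e v u2 = false := eds_indep irr_e edsD vD u2D.
rewrite ltnNge; apply/negP => le.
(* Were the outer neighbours of [v] all adjacent to [v2], the comparison of outdegrees would make
   the two sets equal, yet [u2] belongs to the second only. *)
have /subsetPn[u1] : ~~ ([set t | e v t && (lev v <= lev t)] \subset
                         [set t | e v2 t && (lev v2 <= lev t)]).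
  apply/negP => sub; have /eqP E : [set t | e v t && (lev v <= lev t)] ==
      [set t | e v2 t && (lev v2 <= lev t)] by rewrite eqEcard sub.
  by move/setP: E => /(_ u2); rewrite !inE vu2 v2u2 lv2 lu2.
rewrite !inE lv lv2 => /andP[vu1 lu1]; rewrite lu1 andbT => /negbTE v2u1.
by apply: (unamb lf (w := w) (v1 := v) (v2 := v2) (u1 := u1) (u2 := u2)); split.
Qed.

Lemma min_candidate_in_eds v : candidate v ->
  (forall v', candidate v' -> outdegree v <= outdegree v') -> v \in D.
Proof.
have [v1 [v1D cv1 min1]] := candidate_dominator.
by move=> cv /(_ v1 cv1) le; case: (min1 v cv) => [->//|]; rewrite ltnNge le.
Qed.

End Greedy.

(** * The breadth-first queue *)

Section Queue.

Variables (R : {set T}) (r0 : T).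

(** [h] counts rounds and may run past the end of [q], since the loop always makes n rounds.
    [bfs_sorted] and [bfs_front] together say that from the head on at most two consecutive levels
    occur. *)
Record bfs_inv (h : nat) (q : seq T) (lev : T -> nat) : Prop := BfsInv {
  bfs_uniq : uniq q;
  bfs_mem : forall v, (0 < lev v) = (v \in q);
  bfs_root : forall v, (lev v == 1) = (v \in R);
  bfs_parent : forall v, 1 < lev v -> exists2 u, e u v & (lev u).+1 = lev v;
  bfs_sorted : forall i j, i <= j < size q -> lev (nth r0 q i) <= lev (nth r0 q j);
  bfs_front : h < size q -> forall v, lev v <= (lev (nth r0 q h)).+1;
  bfs_done : forall i v, i < h -> i < size q -> e (nth r0 q i) v ->
    0 < lev v <= (lev (nth r0 q i)).+1
}.

Lemma bfs_init q lev : uniq q -> q =i R -> (forall v, lev v = (v \in R)) ->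
  bfs_inv 0 q lev.
Proof.
move=> uq qR levE; split=> //.
- by move=> v; rewrite levE qR lt0b.
- by move=> v; rewrite levE eqb1.
- by move=> v; rewrite levE; case: (v \in R).
- move=> i j /andP[ij jq]; rewrite !levE -!qR !mem_nth //.
  exact: leq_ltn_trans jq.
- by move=> _ v; rewrite !levE; case: (v \in R).
Qed.

Lemma bfs_push h q lev v : bfs_inv h q lev -> h < size q ->
    e (nth r0 q h) v -> lev v = 0 ->
  bfs_inv h (rcons q v) (fun t => if t == v then (lev (nth r0 q h)).+1 else lev t).
Proof.
move=> [uq qmem root par srt front dn] hq uv v0.
set u := nth r0 q h in uv *.
have vq : v \notin q by rewrite -qmem v0.
have nq i : i < size q -> (nth r0 q i == v) = false.
  by move=> iq; apply/negP => /eqP E; move: vq; rewrite -E mem_nth.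
have u0 : 0 < lev u by rewrite qmem mem_nth.
have nr i : i < size q -> nth r0 (rcons q v) i = nth r0 q i.
  by move=> iq; rewrite nth_rcons iq.
have uv' : (u == v) = false by apply: nq.
split.
- by rewrite rcons_uniq vq.
- by move=> t; rewrite mem_rcons inE; case: eqP.
- move=> t; case: (t =P v) => [->|_] //; rewrite eqSS.
  have -> : (lev u == 0) = false by apply/negP => /eqP E; rewrite E in u0.
  by rewrite -root v0.
- move=> t; case: (t =P v) => [-> _|tv t1]; first by exists u; rewrite ?uv'.
  have [p pt lp] := par t t1; exists p => //; case: eqP => // pv.
  by move: lp t1; rewrite pv v0 => <-.
- move=> i j; rewrite size_rcons ltnS => /andP[ij jq].
  case: (ltnP j (size q)) => jq'.
    rewrite !nr ?nq //; last exact: leq_ltn_trans jq'.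
      by apply: srt; rewrite ij.
    exact: leq_ltn_trans jq'.
  have -> : j = size q by apply/eqP; rewrite eqn_leq jq.
  rewrite [in X in _ <= X]nth_rcons ltnn !eqxx.
  case: (ltnP i (size q)) => iq; first by rewrite nr // nq // front.
  have -> : i = size q by lia.
  by rewrite nth_rcons ltnn !eqxx.
- move=> _ t; rewrite nr // -/u uv'; case: eqP => // _; exact: front.
- move=> i t ih; rewrite size_rcons ltnS => iq.
  have iq' : i < size q by apply: ltn_trans hq.
  rewrite nr // nq // => it; case: eqP => [tv|_]; last exact: dn.
  by have := dn i t ih iq' it; rewrite tv v0.
Qed.

Lemma bfs_next h q lev : bfs_inv h q lev ->
  (h < size q -> forall v, e (nth r0 q h) v -> 0 < lev v) -> bfs_inv h.+1 q lev.
Proof.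
move=> [uq qmem root par srt front dn] nbr; split=> //.
- move=> hq v; apply: leq_trans (front _ v) _; first exact: ltnW.
  by rewrite ltnS srt // leqnSn.
- move=> i v; rewrite ltnS leq_eqVlt => /orP[/eqP->|ih] iq iv; last exact: dn.
  by rewrite nbr // front.
Qed.

Lemma bfs_level h q lev : bfs_inv h q lev -> size q <= h -> level_function e R lev.
Proof.
move=> [uq qmem root par srt front dn] qh; split=> // u v uv.
rewrite qmem => uq'; have iq : index u q < size q by rewrite index_mem.
have := dn (index u q) v; rewrite nth_index //; apply=> //.
exact: leq_trans qh.
Qed.

(** The greedy pass follows the same queue; this supplies its hypothesis [done_below]. *)
Lemma bfs_before h q lev k p : bfs_inv h q lev -> k < size q ->
  0 < lev p < lev (nth r0 q k) -> exists2 i, i < k & nth r0 q i = p.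
Proof.
move=> [uq qmem root par srt front dn] kq /andP[p0 pk].
have pq : p \in q by rewrite -qmem.
exists (index p q); last exact: nth_index.
rewrite ltnNge; apply/negP => le; have := srt k (index p q).
by rewrite le index_mem pq nth_index // leqNgt pk => /(_ isT).
Qed.

End Queue.

(** * Gluing the solutions of components *)

Definition locally_dominated (v : T) : Prop := exists C P : {set T},
  [/\ v \in C, forall x y, x \in C -> e x y -> y \in C
    & forall t, t \in C -> dominators P t = 1].

Lemma closed_connect (C : {set T}) x y :
  (forall x y, x \in C -> e x y -> y \in C) -> connect e x y -> x \in C -> y \in C.
Proof.
move=> closedC /connectP[p]; elim: p x => [|z p IHp] x /=; first by move=> _ ->.
by move=> /andP[xz zp] yE xC; apply: (IHp z) => //; apply: closedC xz.
Qed.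

(** Each component follows the set chosen for its canonical representative. A closed neighbourhood
    stays within one component, so different choices never mix. *)
Lemma local_to_global_eds : (forall v, locally_dominated v) -> has_eds e.
Proof.
move=> /fin_all_exists[C] /fin_all_exists[P locP].
pose rt v := root e v.
have csym := sym_connect_sym sym_e.
exists [set v | v \in P (rt v)] => t.
have [rC clC domC] := locP (rt t).
have tC : t \in C (rt t) by apply: closed_connect rC => //; rewrite csym connect_root.
rewrite -[RHS](domC t tC) /dominators; apply: eq_card => x; rewrite !inE.
case N : (_ || _) => //=; suff -> : rt x = rt t by [].
apply/eqP; rewrite root_connect //; rewrite csym.
by case/orP: N => [/eqP->|tx]; rewrite ?connect0 ?connect1.
Qed.

End Search.

(** * The algorithm *)

(* Register 0 holds n, registers 1-4 the guessed dominators, 7 the length of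
   the queue; array 0 holds the levels, 1 the queue, 2 the outdegrees, 3 the
   numbers of chosen dominators and 4 the vertices already settled. *)
Definition clear_arrays : prog :=
  PFor 6 (PSeq (PPut 0 (Reg 6) (Const 0))
    (PSeq (PPut 2 (Reg 6) (Const 0)) (PPut 3 (Reg 6) (Const 0)))).

Definition add_dominator (x : nat) : prog :=
  PFor 6 (PIf (Op OpAdd (Op OpEq (Reg 6) (Reg x)) (Adj (Reg x) (Reg 6)))
    (PPut 3 (Reg 6) (Op OpAdd (Cell 3 (Reg 6)) (Const 1))) PSkip).

Definition push (x : nat) (E : expr) : prog :=
  PSeq (PPut 0 (Reg x) E) (PSeq (PPut 1 (Reg 7) (Reg x)) (PSet 7 (succ_reg 7))).

(** The test on the level skips repeated guesses, so root sets with fewer than four elements are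
    covered. *)
Definition add_root (x : nat) : prog :=
  PIf (Cell 0 (Reg x)) PSkip (PSeq (push x (Const 1)) (add_dominator x)).

Definition scan_nbrs : prog :=
  PFor 6 (PIf (Adj (Reg 8) (Reg 6))
    (PIf (Cell 0 (Reg 6)) PSkip (push 6 (Op OpAdd (Cell 0 (Reg 8)) (Const 1))))
    PSkip).

Definition bfs : prog :=
  PFor 5 (PIf (Op OpLt (Reg 5) (Reg 7))
    (PSeq (PSet 8 (Cell 1 (Reg 5))) scan_nbrs) PSkip).

Definition count_row : prog :=
  PFor 6 (PIf (Adj (Reg 5) (Reg 6))
    (PIf (Op OpLt (Cell 0 (Reg 6)) (Cell 0 (Reg 5))) PSkip
      (PPut 2 (Reg 5) (Op OpAdd (Cell 2 (Reg 5)) (Const 1)))) PSkip).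

Definition count_outdegrees : prog := PFor 5 count_row.

(** Register 9 holds the best candidate so far, the value n standing for none. *)
Definition select_loop : prog :=
  PFor 6 (PIf (Adj (Reg 8) (Reg 6))
    (PIf (Cell 3 (Reg 6)) PSkip
      (PIf (Op OpEq (Cell 0 (Reg 6)) (Op OpAdd (Cell 0 (Reg 8)) (Const 1)))
        (PIf (Op OpEq (Reg 9) (Reg 0)) (PSet 9 (Reg 6))
          (PIf (Op OpLt (Cell 2 (Reg 6)) (Cell 2 (Reg 9))) (PSet 9 (Reg 6)) PSkip))
        PSkip)) PSkip).

Definition greedy_step : prog :=
  PIf (Cell 3 (Reg 8)) PSkip
    (PSeq (PSeq (PSet 9 (Reg 0)) select_loop)
      (PIf (Op OpLt (Reg 9) (Reg 0)) (add_dominator 9) PSkip)).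

Definition greedy : prog :=
  PFor 5 (PIf (Op OpLt (Reg 5) (Reg 7))
    (PSeq (PSet 8 (Cell 1 (Reg 5))) greedy_step) PSkip).

Definition verify_loop : prog :=
  PFor 6 (PIf (Cell 0 (Reg 6))
    (PIf (Op OpEq (Cell 3 (Reg 6)) (Const 1)) PSkip (PSet 10 (Const 0))) PSkip).

Definition mark_loop : prog :=
  PFor 6 (PIf (Cell 0 (Reg 6)) (PPut 4 (Reg 6) (Const 1)) PSkip).

Definition add_roots : prog :=
  PSeq (PSeq (PSeq (add_root 1) (add_root 2)) (add_root 3)) (add_root 4).

Definition search : prog :=
  PSeq (PSeq (PSeq (PSeq (PSeq clear_arrays (PSet 7 (Const 0))) add_roots) bfs)
    count_outdegrees) greedy.

Definition attempt : prog :=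
  PSeq (PSeq (PSeq search (PSet 10 (Const 1))) verify_loop)
    (PIf (Reg 10) mark_loop PSkip).

Definition final_loop : prog :=
  PFor 6 (PIf (Cell 4 (Reg 6)) PSkip (PSet 10 (Const 0))).

Definition eds_prog : prog :=
  PSeq (PSeq (PFor 1 (PFor 2 (PFor 3 (PFor 4 attempt)))) (PSet 10 (Const 1)))
    final_loop.

Lemma wf_eds_prog : wf eds_prog. Proof. by []. Qed.

(** * Correctness of the program *)

Section Correctness.

Variables (n : nat) (e : rel 'I_n).
Hypotheses (sym_e : symmetric e) (irr_e : irreflexive e).

Definition ready (s : state) : Prop :=
  regs s 0 = n /\ forall u v : 'I_n, mem s (u * n + v) = e u v.

Lemma matrix_index_lt (u v : 'I_n) : u * n + v < n * n.
Proof. by have := ltn_ord u; have := ltn_ord v; nia. Qed.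

Lemma ready_input : ready (input e).
Proof.
split=> // u v; rewrite /= /adj_mem; congr nat_of_bool.
have n0 : 0 < n by apply: leq_ltn_trans (ltn_ord u).
apply/existsP/idP => [[u' /existsP[v' /andP[/eqP E uv]]]|uv]; last first.
  by exists u; apply/existsP; exists v; rewrite eqxx.
have uu : u = u'.
  by apply: ord_inj; move/(congr1 (divn^~ n)): E; rewrite !divnMDl // !divn_small // !addn0.
have vv : v = v'.
  by apply: ord_inj; move/(congr1 (modn^~ n)): E; rewrite !modnMDl !modn_small.
by rewrite uu vv.
Qed.

Lemma frame_ready p s s' : wf p -> frame p s s' -> ready s -> ready s'.
Proof.
move=> wp [fr _ fl] [s0 adj]; split; first by rewrite fr ?wf_assigns0.
by move=> u v; rewrite fl ?adj // s0 matrix_index_lt.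
Qed.

Lemma ready_sem p s : wf p -> ready s -> ready (sem p s).
Proof. by move=> wp; apply: (frame_ready wp (sem_frame s wp)). Qed.

Lemma ready_set_reg s x v : x != 0 -> ready s -> ready (set_reg s x v).
Proof. by move=> x0 [s0 adj]; split=> //=; rewrite /update eq_sym (negbTE x0). Qed.

Lemma ev_Adj s X Y (u v : 'I_n) : ready s -> ev s X = u -> ev s Y = v ->
  ev s (Adj X Y) = e u v.
Proof. by move=> [s0 adj] /= -> ->; rewrite s0 adj. Qed.

Lemma ltS_ord k (lt : k < n) (i : 'I_n) : (i < k.+1) = (i == Ordinal lt) || (i < k).
Proof. by rewrite ltnS leq_eqVlt. Qed.

Lemma forall_ltS k (lt : k < n) (Q : pred 'I_n) :
  [forall t : 'I_n, (t < k.+1) ==> Q t] =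
  Q (Ordinal lt) && [forall t : 'I_n, (t < k) ==> Q t].
Proof.
apply/forallP/andP => [all|[Qk /forallP all] t].
  split; first by have := all (Ordinal lt); rewrite (ltS_ord lt) eqxx.
  apply/forallP => t; apply/implyP => tk.
  by have /implyP := all t; apply; rewrite (ltS_ord lt) tk orbT.
apply/implyP; rewrite (ltS_ord lt) => /orP[/eqP->//|tk].
by have /implyP := all t; apply.
Qed.

Lemma clear_arraysP s (i : 'I_n) : ready s -> let s' := sem clear_arrays s in
  [/\ arr s' 0 i = 0, arr s' 2 i = 0 & arr s' 3 i = 0].
Proof.
move=> [s0 _] /=.
pose Inv k s' := forall i : 'I_n, i < k -> [/\ arr s' 0 i = 0, arr s' 2 i = 0 & arr s' 3 i = 0].
suff : Inv n (sem clear_arrays s) by apply.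
apply: sem_for => // k s' lt _ r6 inv j.
rewrite (ltS_ord lt) !semE !evE !arr_put //= r6.
case: eqP => [->|_ /= jk]; first by rewrite eqxx.
by case: eqP => // _; apply: inv.
Qed.

Lemma add_dominatorP x (r : 'I_n) s (i : 'I_n) :
    ready s -> regs s x = r -> x != 6 ->
  arr (sem (add_dominator x) s) 3 i = arr s 3 i + ((i == r) || e r i).
Proof.
move=> rs sx x6.
pose Inv k s' := forall i : 'I_n,
  arr s' 3 i = arr s 3 i + ((i < k) && ((i == r) || e r i)).
suff : Inv n (sem (add_dominator x) s) by move->; rewrite ltn_ord.
apply: sem_for => //; first by case: rs.
- by move=> j; rewrite addn0.
move=> k s' lt fr r6 inv j; rewrite (ltS_ord lt).
have rs' : ready s' by apply: frame_ready fr rs.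
have s'x : regs s' x = r by rewrite (frame_reg fr) //= orbF.
have E : ev s' (Op OpAdd (Op OpEq (Reg 6) (Reg x)) (Adj (Reg x) (Reg 6))) =
    (Ordinal lt == r) + e r (Ordinal lt).
  by rewrite ev_Op (@ev_Adj s' (Reg x) (Reg 6) r (Ordinal lt)) // !evE r6 s'x.
rewrite semE E; case: ifP => C; rewrite !semE ?evE ?arr_put //= ?r6 inv.
  case: (j =P Ordinal lt) => [->|jk] /=; last first.
    by rewrite ifN //; apply/eqP => jE; apply: jk; apply: ord_inj.
  rewrite eqxx; have := inv (Ordinal lt); rewrite ltnn addn0 /= => ->.
  by move: C; case: (_ == r); case: (e _ _).
case: (j =P Ordinal lt) => [->|jk] //=; rewrite ltnn.
by move: C; case: (_ == r); case: (e _ _).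
Qed.

Section Attempt.

Variable r0 : 'I_n.

Definition is_queue (q : seq 'I_n) (s : state) : Prop :=
  regs s 7 = size q /\ forall k, k < size q -> arr s 1 k = nth r0 q k.

Lemma pushP x E (v : 'I_n) q s : x != 7 -> regs s x = v -> is_queue q s ->
  let s' := sem (push x E) s in is_queue (rcons q v) s' /\
  forall t : 'I_n, arr s' 0 t = if t == v then ev s E else arr s 0 t.
Proof.
move=> x7 sx [s7 qs]; rewrite /push !semE /succ_reg !evE /=.
split; last by move=> t; rewrite arr_set_reg // !arr_put //= sx.
split; first by rewrite /update /= s7 size_rcons addn1.
move=> k; rewrite size_rcons ltnS arr_set_reg // !arr_put //= s7 sx nth_rcons.
case: ltngtP => // kq _; exact: qs.
Qed.

Lemma add_dominator_dominators x (r : 'I_n) (P : {set 'I_n}) s :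
    ready s -> regs s x = r -> x != 6 -> r \notin P ->
    (forall t : 'I_n, arr s 3 t = dominators e P t) ->
  forall t : 'I_n, arr (sem (add_dominator x) s) 3 t = dominators e (r |: P) t.
Proof.
by move=> rs sx x6 rP domP t; rewrite (add_dominatorP _ rs sx x6) domP dominatorsU1.
Qed.

Definition rooted (R : {set 'I_n}) (s : state) : Prop := exists q,
  [/\ is_queue q s, uniq q, q =i R, forall v : 'I_n, arr s 0 v = (v \in R)
    & forall t : 'I_n, arr s 3 t = dominators e R t].

Lemma add_rootP x (r : 'I_n) R s :
    x != 0 -> x != 6 -> x != 7 -> ready s -> regs s x = r -> rooted R s ->
  rooted (R :|: [set r]) (sem (add_root x) s).
Proof.
move=> x0 x6 x7 rs sx [q [qs uq qR levR domR]].
rewrite /add_root sem_PIf !evE sx levR; case: ifP => [rR|/negbFE/eqP rR].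
  have -> : R :|: [set r] = R.
    by apply/setUidPl; rewrite sub1set; move: rR; case: (r \in R).
  by exists q.
have {}rR : r \notin R by move: rR; case: (r \in R).
have [qs' lev'] := pushP (Const 1) x7 sx qs.
rewrite sem_PSeq; set s1 := sem (push x (Const 1)) s in qs' lev' *.
have wfp : wf (push x (Const 1)) by [].
have fr1 : frame (push x (Const 1)) s s1 by apply: sem_frame.
have rs1 : ready s1 by apply: frame_ready fr1 rs.
have s1x : regs s1 x = r by rewrite (frame_reg fr1) //= orbF.
have fr2 : frame (add_dominator x) s1 (sem (add_dominator x) s1) by apply: sem_frame.
exists (rcons q r); split.
- case: qs' => s17 qs'; split; first by rewrite (frame_reg fr2).
  by move=> k /qs' <-; rewrite (frame_arr fr2).
- by rewrite rcons_uniq qR rR.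
- by move=> v; rewrite mem_rcons !inE qR orbC.
- by move=> v; rewrite (frame_arr fr2) // lev' levR !inE; case: eqP; rewrite ?orbT ?orbF.
- move=> t; rewrite setUC; apply: add_dominator_dominators => // v.
  by rewrite (frame_arr fr1) // domR.
Qed.

Definition searched (R : {set 'I_n}) (h : nat) (s : state) : Prop :=
  exists q lev, [/\ is_queue q s, forall v : 'I_n, arr s 0 v = lev v
    & bfs_inv e R r0 h q lev].

Lemma scan_nbrsP R h (u : 'I_n) s : ready s -> regs s 8 = u ->
    (exists q lev, [/\ is_queue q s, forall v : 'I_n, arr s 0 v = lev v,
       bfs_inv e R r0 h q lev & h < size q /\ nth r0 q h = u]) ->
  searched R h.+1 (sem scan_nbrs s).
Proof.
move=> rs s8 init.
pose Inv k s' := exists q lev, [/\ is_queue q s', forall v : 'I_n, arr s' 0 v = lev v,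
  bfs_inv e R r0 h q lev, h < size q /\ nth r0 q h = u
  & forall v : 'I_n, v < k -> e u v -> 0 < lev v].
suff [q [lev [qs levE bi [hq qh] scanned]]] : Inv n (sem scan_nbrs s).
  exists q, lev; split=> //; apply: bfs_next => // _ v.
  by rewrite qh; apply: scanned.
apply: sem_for => //; first by case: rs.
  by have [q [lev [qs levE bi hq]]] := init; exists q, lev; split.
move=> k s' lt fr r6 [q [lev [qs levE bi [hq qh] scanned]]].
have rs' : ready s' by apply: frame_ready fr rs.
have s'8 : regs s' 8 = u by rewrite (frame_reg fr).
pose v := Ordinal lt; have s'6 : regs s' 6 = v by [].
rewrite sem_PIf (ev_Adj (u := u) (v := v) rs') // eqb0 negbK.
case: ifP => uv; last first.
  exists q, lev; split=> // t; rewrite (ltS_ord lt) => /orP[/eqP->|]; first by rewrite uv.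
  exact: scanned.
rewrite sem_PIf !evE s'6 levE; case: ifP => [lev_v|/negbFE/eqP lev_v].
  exists q, lev; split=> // t; rewrite (ltS_ord lt) => /orP[/eqP-> _|]; last exact: scanned.
  by rewrite lt0n.
have [] := pushP (x := 6) (Op OpAdd (Cell 0 (Reg 8)) (Const 1)) _ s'6 qs => //.
rewrite !evE s'8 levE; set s1 := sem _ _ => qs' lev'.
exists (rcons q v), (fun t => if t == v then (lev (nth r0 q h)).+1 else lev t); split=> //.
- by move=> t; rewrite lev' levE qh /= addn1.
- by apply: bfs_push; rewrite ?qh.
- by rewrite size_rcons nth_rcons hq ltnS; split=> //; apply: ltnW.
move=> t; rewrite (ltS_ord lt); case: (t == v) => //=; exact: scanned.
Qed.

Lemma bfsP R s : ready s -> searched R 0 s -> searched R n (sem bfs s).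
Proof.
move=> rs init; apply: (sem_for (Inv := searched R)) => //; first by case: rs.
move=> k s' lt fr r5 [q [lev [qs levE bi]]].
have rs' : ready s' by apply: frame_ready fr rs.
have [s'7 qE] := qs; rewrite sem_PIf !evE r5 s'7 [apply_op _ _ _]/= eqb0 negbK.
case: ltnP => kq; last first.
  by exists q, lev; split=> //; apply: bfs_next => //; rewrite ltnNge kq.
rewrite sem_PSeq sem_PSet !evE r5 qE //.
apply: (scan_nbrsP (u := nth r0 q k)) => //.
by exists q, lev.
Qed.

Lemma count_outdegreesP s : ready s -> (forall v : 'I_n, arr s 2 v = 0) ->
  let s' := sem count_outdegrees s in
  forall v : 'I_n, arr s' 2 v = outdegree e (fun t : 'I_n => arr s 0 t) v.
Proof.
move=> rs cnt0 /=; set lev := fun t : 'I_n => arr s 0 t.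
have sizeE : size (enum 'I_n) = n by rewrite size_enum_ord.
have takeS k (lt : k < n) : take k.+1 (enum 'I_n) = rcons (take k (enum 'I_n)) (Ordinal lt).
  by rewrite (take_nth r0) ?sizeE //; congr rcons; apply: (nth_ord_enum r0 (Ordinal lt)).
pose Q v := [pred t | e v t && (lev v <= lev t)].
have QE v : count (Q v) (take n (enum 'I_n)) = outdegree e lev v.
  rewrite take_oversize ?sizeE // /outdegree cardsE cardE -size_filter enumT.
  by rewrite /enum_mem; congr size; apply: eq_filter => t; rewrite inE.
pose Inv1 k s' := forall v : 'I_n,
  arr s' 2 v = if v < k then outdegree e lev v else 0.
suff H : Inv1 n (sem count_outdegrees s) by move=> v; rewrite H ltn_ord.
apply: sem_for => //; first by case: rs.
move=> k s' lt fr r5 inv1.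
have rs' : ready s' by apply: frame_ready fr rs.
pose v := Ordinal lt; have s'5 : regs s' 5 = v by [].
pose Inv2 i s2 := forall t : 'I_n,
  arr s2 2 t = if t == v then count (Q v) (take i (enum 'I_n)) else arr s' 2 t.
suff H : Inv2 n (sem count_row s').
  by move=> t; rewrite H (ltS_ord lt); case: eqP => [->|_] //=.
apply: sem_for => //; first by case: rs'.
  by move=> t; rewrite take0 /= inv1; case: eqP => // ->; rewrite ltnn.
move=> i s2 lt2 fr2 r6 inv2 t.
have rs2 : ready s2 by apply: frame_ready fr2 rs'.
pose u := Ordinal lt2; have s26 : regs s2 6 = u by [].
have s25 : regs s2 5 = v by rewrite (frame_reg fr2).
have levE (x : 'I_n) : arr s2 0 x = lev x by rewrite (frame_arr fr2) // (frame_arr fr).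
rewrite (takeS i lt2) -cats1 count_cat [count _ [:: _]]/= addn0 -/u.
rewrite sem_PIf (ev_Adj (u := v) (v := u) rs2) // eqb0 negbK.
case: (e v u); last by rewrite sem_PSkip inv2 addn0.
rewrite sem_PIf !evE s25 s26 !levE [apply_op _ _ _]/= eqb0 negbK ltnNge.
case: (lev v <= lev u); last by rewrite sem_PSkip inv2 addn0.
rewrite sem_PPut arr_put // !evE s25 !inv2 eqxx /=.
by case: (t =P v) => [->|tv]; rewrite ?eqxx // ifN //; apply/eqP => E; apply: tv; apply: ord_inj.
Qed.

Lemma select_loopP (w : 'I_n) s : ready s -> regs s 8 = w -> regs s 9 = n ->
  let cand v := [&& e w v, arr s 3 v == 0 & arr s 0 v == (arr s 0 w).+1] in
  let b := regs (sem select_loop s) 9 in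
  (b = n /\ forall v, ~~ cand v) \/
  exists v : 'I_n, [/\ b = v, cand v & forall v', cand v' -> arr s 2 v <= arr s 2 v'].
Proof.
move=> rs s8 s9 cand /=.
pose Inv k s' := (regs s' 9 = n /\ forall v : 'I_n, v < k -> ~~ cand v) \/
  exists v : 'I_n, [/\ regs s' 9 = v, cand v
    & forall v' : 'I_n, v' < k -> cand v' -> arr s 2 v <= arr s 2 v'].
suff [[r9 nc]|[v [r9 cv min]]] : Inv n (sem select_loop s).
- by left; split=> // v; apply: nc.
- by right; exists v; split=> // v'; apply: min.
apply: sem_for => //; [by case: rs | by left|].
move=> k s' lt fr r6 inv.
have rs' : ready s' by apply: frame_ready fr rs.
pose v := Ordinal lt; have s'6 : regs s' 6 = v by [].
have s'8 : regs s' 8 = w by rewrite (frame_reg fr).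
have s'0 : regs s' 0 = n by case: rs'.
have arrE j (x : 'I_n) : j < 8 -> arr s' j x = arr s j x.
  by move=> j8; rewrite (frame_arr fr).
have skip : ~~ cand v -> Inv k.+1 s'.
  move=> ncv; case: inv => [[r9 nc]|[b [r9 cb min]]]; [left|right].
    by split=> // t; rewrite (ltS_ord lt) => /orP[/eqP->|/nc].
  exists b; split=> // t; rewrite (ltS_ord lt) => /orP[/eqP->|/min//].
  by move=> cv; rewrite cv in ncv.
have take9 : cand v -> (forall t : 'I_n, t < k -> cand t -> arr s 2 v <= arr s 2 t) ->
    Inv k.+1 (set_reg s' 9 (regs s' 6)).
  move=> cv min; right; exists v; split=> // t.
  by rewrite (ltS_ord lt) => /orP[/eqP->|/min].
rewrite sem_PIf (ev_Adj (u := w) (v := v) rs') // eqb0 negbK.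
case: ifP => wv; last by apply: skip; rewrite /cand wv.
rewrite sem_PIf !evE s'6 arrE //; case: ifP => [dv|/negbFE dv].
  by apply: skip; rewrite /cand (negbTE dv) andbF.
rewrite sem_PIf !evE s'6 s'8 !arrE // [apply_op _ _ _]/= eqb0 negbK.
rewrite addn1; case: ifP => lv; last first.
  by apply: skip; rewrite /cand lv !andbF.
have cv : cand v by rewrite /cand wv dv lv.
rewrite sem_PIf !evE s'0 [apply_op _ _ _]/= eqb0 negbK.
case: inv => [[r9 nc]|[b [r9 cb min]]].
  rewrite r9 eqxx sem_PSet !evE; apply: take9 => // t tk ct.
  by have := nc t tk; rewrite ct.
rewrite r9 [nat_of_ord b == n]ltn_eqF // sem_PIf !evE s'6 r9 !arrE //.
rewrite [apply_op _ _ _]/= eqb0 negbK; case: ltnP => vb.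
  rewrite sem_PSet !evE; apply: take9 => // t tk ct.
  exact: leq_trans (ltnW vb) (min t tk ct).
by right; exists b; split=> // t; rewrite (ltS_ord lt) => /orP[/eqP->|/min].
Qed.

(** Whatever the guess, array 3 counts dominators from some [P], which the final check can trust;
    only for a right guess is [P] part of an e.d.s. The program does not know [D], hence [P] is
    chosen before it. *)
Definition greedy_inv (R : {set 'I_n}) q (k : nat) (s : state) : Prop :=
  exists P : {set 'I_n}, (forall t : 'I_n, arr s 3 t = dominators e P t) /\
    forall D, efficient_dominating_set e D -> R \subset D -> unambiguous e D R ->
      [/\ R \subset P, P \subset D
        & forall j, j < k -> j < size q -> 0 < dominators e P (nth r0 q j)].

Lemma greedyP R q lev s : ready s -> is_queue q s ->
    (forall v : 'I_n, arr s 0 v = lev v) -> bfs_inv e R r0 n q lev ->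
    (forall v : 'I_n, arr s 2 v = outdegree e lev v) ->
    (forall t : 'I_n, arr s 3 t = dominators e R t) ->
  greedy_inv R q n (sem greedy s).
Proof.
move=> rs [s7 qE] levE bi cntE domE.
have size_q : size q <= n by rewrite -[X in _ <= X]card_ord -(card_uniqP (bfs_uniq bi)) max_card.
have lf := bfs_level bi size_q.
apply: (sem_for (Inv := greedy_inv R q)) => //; first by case: rs.
  by exists R; split.
move=> k s' lt fr r5 inv.
have rs' : ready s' by apply: frame_ready fr rs.
rewrite sem_PIf !evE r5 (frame_reg fr) // s7 [apply_op _ _ _]/= eqb0 negbK.
have [P [domP invP]] := inv.
have last_dominated P' s1 : (forall t : 'I_n, arr s1 3 t = dominators e P' t) ->
    (forall D, efficient_dominating_set e D -> R \subset D -> unambiguous e D R ->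
      [/\ R \subset P', P \subset P', P' \subset D
        & k < size q -> 0 < dominators e P' (nth r0 q k)]) ->
    greedy_inv R q k.+1 s1.
  move=> dom1 inv1; exists P'; split=> // D edsD RD unamb.
  have [RP PD old] := invP D edsD RD unamb.
  have [RP' PP' PD' new] := inv1 D edsD RD unamb.
  split=> // j; rewrite ltnS leq_eqVlt => /orP[/eqP->//|jk jq].
  apply: leq_trans (old j jk jq) _; apply: subset_leq_card; exact: setIS.
case: ltnP => kq; last first.
  rewrite sem_PSkip; apply: (last_dominated P) => // D edsD RD unamb.
  by have [RP PD old] := invP D edsD RD unamb; split=> //; rewrite ltnNge kq.
rewrite sem_PSeq sem_PSet !evE r5 (frame_arr fr) // qE //.
set w := nth r0 q k; set s1 := set_reg s' 8 w.
have rs1 : ready s1 by [].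
have s18 : regs s1 8 = w by [].
have arr1 j (x : 'I_n) : j < 3 -> arr s1 j x = arr s j x.
  by case: j => [|[|[|]]] // _; rewrite arr_set_reg // (frame_arr fr).
have dom1 (t : 'I_n) : arr s1 3 t = dominators e P t by rewrite arr_set_reg // domP.
rewrite sem_PIf !evE s18 dom1; case: ifP => [dw|/negbFE/eqP dw].
  rewrite sem_PSkip; apply: (last_dominated P) => // D edsD RD unamb.
  by have [RP PD old] := invP D edsD RD unamb; split=> //; rewrite lt0n.
rewrite sem_PSeq [sem (PSeq (PSet 9 _) _) _]sem_PSeq sem_PSet !evE.
set s2 := set_reg s1 9 _.
have rs2 : ready s2 by [].
have s29 : regs s2 9 = n by case: rs1.
have wfs : wf select_loop by [].
have := select_loopP rs2 (w := w) erefl s29.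
have fr3 := sem_frame s2 wfs; have rs3 := ready_sem wfs rs2.
set s3 := sem select_loop s2 in fr3 rs3 * => sel.
have s30 : regs s3 0 = n by case: rs3.
have candE v : [&& e w v, arr s2 3 v == 0 & arr s2 0 v == (arr s2 0 w).+1] =
    candidate e P lev w v.
  by rewrite /candidate !(arr_set_reg s1) // dom1 !arr1 // !levE.
have arr2 (v : 'I_n) : arr s2 2 v = outdegree e lev v.
  by rewrite (arr_set_reg s1) // arr1.
have dom3 (t : 'I_n) : arr s3 3 t = dominators e P t.
  by rewrite (frame_arr fr3) // (arr_set_reg s1).
have w0 : 0 < lev w by rewrite (bfs_mem bi) mem_nth.
have below D : efficient_dominating_set e D -> R \subset D -> unambiguous e D R ->
    forall p, 0 < lev p < lev w -> 0 < dominators e P p.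
  move=> edsD RD unamb p pw; have [RP PD old] := invP D edsD RD unamb.
  have [i ik <-] := bfs_before bi kq pw; apply: old => //; exact: ltn_trans kq.
rewrite sem_PIf !evE s30 [apply_op _ _ _]/= eqb0 negbK.
case: sel => [[-> nc]|[v [s3v]]].
  rewrite ltnn sem_PSkip; apply: (last_dominated P) => // D edsD RD unamb.
  have [RP PD old] := invP D edsD RD unamb.
  have [v [_ cv _]] :=
    candidate_dominator irr_e edsD unamb lf RP PD w0 (below D edsD RD unamb) dw.
  by have := nc v; rewrite candE cv.
rewrite candE => cv minv; rewrite s3v ltn_ord.
have vP : v \notin P by case/and3P: cv => _ /eqP/dominators_eq0.
apply: (last_dominated (v |: P)) => [|D edsD RD unamb].
  by apply: (add_dominator_dominators rs3).
have [RP PD old] := invP D edsD RD unamb.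
have vD : v \in D.
  apply: (min_candidate_in_eds irr_e edsD unamb lf RP PD w0 (below D edsD RD unamb) dw cv).
  by move=> v' cv'; rewrite -!arr2; apply: minv; rewrite candE.
split.
- exact: subset_trans RP (subsetUr _ _).
- exact: subsetUr.
- by rewrite subUset sub1set vD.
move=> _; apply/dominators_gt0P; exists v; first by rewrite !inE eqxx.
by case/and3P: cv => -> _ _; rewrite orbT.
Qed.

End Attempt.

Section Guess.

Variables a b c d : 'I_n.
Let R : {set 'I_n} := [set a; b; c; d].

Definition guessed (s : state) : Prop :=
  [/\ ready s, regs s 1 = a, regs s 2 = b, regs s 3 = c & regs s 4 = d].

Lemma guessed_sem p s : wf p -> ~~ assigns 1 p -> ~~ assigns 2 p ->
  ~~ assigns 3 p -> ~~ assigns 4 p -> guessed s -> guessed (sem p s).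
Proof.
move=> wp p1 p2 p3 p4 [rs s1 s2 s3 s4].
by split; rewrite ?sem_reg //; apply: ready_sem.
Qed.

Lemma add_rootsP s : guessed s -> rooted a set0 s -> rooted a R (sem add_roots s).
Proof.
move=> g0 rt0; rewrite /add_roots 3!sem_PSeq.
have [rs0 s01 _ _ _] := g0.
have rt1 := add_rootP (x := 1) isT isT isT rs0 s01 rt0.
have g1 : guessed (sem (add_root 1) s) by apply: guessed_sem.
have [rs1 _ s12 _ _] := g1.
have rt2 := add_rootP (x := 2) isT isT isT rs1 s12 rt1.
have g2 : guessed (sem (add_root 2) (sem (add_root 1) s)) by apply: guessed_sem.
have [rs2 _ _ s23 _] := g2.
have rt3 := add_rootP (x := 3) isT isT isT rs2 s23 rt2.
have g3 : guessed (sem (add_root 3) (sem (add_root 2) (sem (add_root 1) s))).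
  by apply: guessed_sem.
have [rs3 _ _ _ s34] := g3.
by have := add_rootP (x := 4) isT isT isT rs3 s34 rt3; rewrite set0U.
Qed.

Lemma searchP s : guessed s -> let s' := sem search s in
  exists lev (P : {set 'I_n}), [/\ forall v : 'I_n, arr s' 0 v = lev v,
    level_function e R lev, forall t : 'I_n, arr s' 3 t = dominators e P t
    & forall D, efficient_dominating_set e D -> R \subset D -> unambiguous e D R ->
        P \subset D /\ forall v, 0 < lev v -> 0 < dominators e P v].
Proof.
move=> gs; rewrite /search 5!sem_PSeq.
set s1 := sem (PSet 7 _) _.
have gs1 : guessed s1 by apply: guessed_sem => //; apply: guessed_sem.
have cleared (i : 'I_n) : [/\ arr s1 0 i = 0, arr s1 2 i = 0 & arr s1 3 i = 0].
  by rewrite /s1 sem_PSet !arr_set_reg //; apply: clear_arraysP; case: gs.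
have rt1 : rooted a set0 s1.
  exists [::]; split=> // v; case: (cleared v) => lv _ dv; rewrite ?inE //.
  by rewrite dv dominators0.
have rt2 := add_rootsP gs1 rt1.
have wf2 : wf add_roots by [].
have fr2 := sem_frame s1 wf2; set s2 := sem add_roots s1 in rt2 fr2 *.
have rs2 : ready s2 by apply: frame_ready fr2 _; case: gs1.
have [q0 [qs0 uq0 q0R lev0 dom2]] := rt2.
have bi0 : searched a R 0 s2.
  exists q0, (fun v => v \in R : nat); split=> //; exact: bfs_init.
have [q [lev [qs3 lev3 bi]]] := bfsP rs2 bi0.
have wf3 : wf bfs by []; have fr3 := sem_frame s2 wf3; have rs3 := ready_sem wf3 rs2.
set s3 := sem bfs s2 in qs3 lev3 fr3 rs3 *.
have cnt3 (v : 'I_n) : arr s3 2 v = 0.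
  by rewrite (frame_arr fr3) // (frame_arr fr2) //; case: (cleared v).
have cnt4 := count_outdegreesP a rs3 cnt3.
have wf4 : wf count_outdegrees by [].
have fr4 := sem_frame s3 wf4; have rs4 := ready_sem wf4 rs3.
set s4 := sem count_outdegrees s3 in cnt4 fr4 rs4 *.
have lev4 (v : 'I_n) : arr s4 0 v = lev v by rewrite (frame_arr fr4).
have qs4 : is_queue a q s4.
  case: qs3 => s37 qE; split; first by rewrite (frame_reg fr4).
  by move=> k kq; rewrite (frame_arr fr4) // qE.
have {}cnt4 (v : 'I_n) : arr s4 2 v = outdegree e lev v.
  rewrite cnt4; apply: eq_card => t; by rewrite !inE !lev3.
have dom4 (t : 'I_n) : arr s4 3 t = dominators e R t.
  by rewrite (frame_arr fr4) // (frame_arr fr3).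
have [P [dom5 inv5]] := greedyP rs4 qs4 lev4 bi cnt4 dom4.
have wf5 : wf greedy by []; have fr5 := sem_frame s4 wf5.
have size_q : size q <= n.
  by rewrite -[X in _ <= X]card_ord -(card_uniqP (bfs_uniq bi)) max_card.
exists lev, P; split=> //.
- by move=> v; rewrite (frame_arr fr5).
- exact: bfs_level bi size_q.
move=> D edsD RD unamb; have [_ PD dom] := inv5 D edsD RD unamb.
split=> // v; rewrite (bfs_mem bi) => vq.
have iq : index v q < size q by rewrite index_mem.
by have := dom _ (leq_trans iq size_q) iq; rewrite nth_index.
Qed.

Lemma verify_loopP s : ready s -> regs s 10 = 1 ->
  (regs (sem verify_loop s) 10 != 0) =
  [forall v : 'I_n, (arr s 0 v != 0) ==> (arr s 3 v == 1)].
Proof.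
move=> rs s10.
pose good v := (arr s 0 v != 0) ==> (arr s 3 v == 1).
pose Inv k s' := (regs s' 10 != 0) = [forall v : 'I_n, (v < k) ==> good v].
suff -> : Inv n (sem verify_loop s).
  by apply: eq_forallb => v; rewrite ltn_ord.
apply: sem_for => //; first by case: rs.
  by rewrite /Inv s10; apply/esym/forallP.
move=> k s' lt fr r6 inv; pose v := Ordinal lt; have s'6 : regs s' 6 = v by [].
rewrite /Inv (forall_ltS lt) -inv sem_PIf !evE s'6 (frame_arr fr) // /good.
case: ifP => _ //; rewrite sem_PIf !evE s'6 (frame_arr fr) // [apply_op _ _ _]/= eqb0 negbK.
by case: ifP.
Qed.

Lemma mark_loopP s (v : 'I_n) : ready s ->
  arr (sem mark_loop s) 4 v = if arr s 0 v != 0 then 1 else arr s 4 v.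
Proof.
move=> rs.
pose Inv k s' := forall t : 'I_n,
  arr s' 4 t = if (t < k) && (arr s 0 t != 0) then 1 else arr s 4 t.
suff -> : Inv n (sem mark_loop s) by rewrite ltn_ord.
apply: sem_for => //; first by case: rs.
move=> k s' lt fr r6 inv t; pose u := Ordinal lt; have s'6 : regs s' 6 = u by [].
rewrite (ltS_ord lt) -/u sem_PIf !evE s'6 (frame_arr fr) //.
case: ifP => lu; rewrite ?sem_PSkip ?sem_PPut ?arr_put // ?evE ?s'6 inv /=.
  case: (t =P u) => [->|tu]; first by rewrite eqxx lu.
  by rewrite ifN //; apply/eqP => E; apply: tu; apply: ord_inj.
by case: (t =P u) => [->|tu] //; rewrite lu andbF.
Qed.

Definition settles (v : 'I_n) : Prop := exists D, [/\ efficient_dominating_set e D,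
  R \subset D, unambiguous e D R & connect e a v].

Lemma attemptP s : guessed s -> let s' := sem attempt s in
  [/\ forall v : 'I_n, arr s 4 v != 0 -> arr s' 4 v != 0,
      forall v : 'I_n, arr s' 4 v != 0 -> arr s 4 v != 0 \/ locally_dominated e v
    & forall v : 'I_n, settles v -> arr s' 4 v != 0].
Proof.
move=> gs; rewrite /attempt 3!sem_PSeq.
have wfs : wf search by [].
have fr1 := sem_frame s wfs; have gs1 := guessed_sem wfs isT isT isT isT gs.
have [lev [P [lev1 lf dom1 invP]]] := searchP gs.
set s1 := sem search s in fr1 gs1 lev1 dom1 *.
set s2 := sem (PSet 10 _) s1.
have rs2 : ready s2 by apply: ready_set_reg => //; case: gs1.
have arr2 j (v : 'I_n) : arr s2 j v = arr s1 j v by rewrite arr_set_reg.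
have := verify_loopP rs2 erefl.
have wfv : wf verify_loop by [].
have fr3 := sem_frame s2 wfv; have rs3 := ready_sem wfv rs2.
set s3 := sem verify_loop s2 in fr3 rs3 * => ver.
have arr3 j (v : 'I_n) : j < 8 -> arr s3 j v = arr s1 j v.
  by move=> j8; rewrite (frame_arr fr3) // arr2.
have arr4 (v : 'I_n) : arr s3 4 v = arr s 4 v by rewrite arr3 // (frame_arr fr1).
rewrite sem_PIf !evE ver; set ok := [forall _, _].
have okP : ok = [forall v, (0 < lev v) ==> (dominators e P v == 1)].
  by apply: eq_forallb => v; rewrite !arr2 lev1 dom1 lt0n.
have [root step par] := lf.
case: ifP => okT; last first.
  rewrite sem_PSkip; split=> [v|v|v [D [edsD RD unamb av]]]; rewrite ?arr4 //.
    by left.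
  (* A right guess passes the check: the search dominates every reached vertex at least once, and a
     subset of [D] does so at most once. *)
  have [PD dom] := invP D edsD RD unamb.
  case/negP: okT; rewrite okP; apply/forallP => t; apply/implyP => t0.
  by apply/eqP; apply: (dominators_sub_eds edsD PD); apply: dom.
split=> v; rewrite mark_loopP // arr4 arr3 // lev1.
- by case: ifP.
- case: ifP => [lv _|_]; [right | by left].
  exists [set t | 0 < lev t], P; split.
  + by rewrite inE lt0n.
  + by move=> x y; rewrite !inE => x0 xy; case/andP: (step x y xy x0).
  + by move=> t; rewrite inE => t0; move: okT; rewrite okP => /forallP/(_ t)/implyP/(_ t0)/eqP.
move=> [D [_ _ _ av]].
have closedL x y : x \in [set t | 0 < lev t] -> e x y -> y \in [set t | 0 < lev t].
  by rewrite !inE => x0 xy; case/andP: (step x y xy x0).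
have : v \in [set t | 0 < lev t].
  apply: (closed_connect closedL av); rewrite inE.
  have /eqP-> : lev a == 1 by rewrite root !inE eqxx.
  by [].
by rewrite inE lt0n => ->.
Qed.

End Guess.

Definition sound (s : state) : Prop :=
  forall v : 'I_n, arr s 4 v != 0 -> locally_dominated e v.

(** Monotonicity is what carries the marks of one guess through all later ones, so that the property
    passes through the four nested loops. *)
Record progress (s s' : state) (X : 'I_n -> Prop) : Prop := Progress {
  progress_mono : forall v : 'I_n, arr s 4 v != 0 -> arr s' 4 v != 0;
  progress_sound : sound s -> sound s';
  progress_settled : forall v : 'I_n, X v -> arr s' 4 v != 0
}.

Lemma for_progress x p (X : 'I_n -> 'I_n -> Prop) s : wf (PFor x p) -> ready s ->
    (forall (i : 'I_n) s', frame (PFor x p) s s' -> ready s' -> regs s' x = i ->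
       progress s' (sem p s') (X i)) ->
  progress s (sem (PFor x p) s) (fun v => exists i, X i v).
Proof.
move=> wfx rs body; have x0 : x != 0 by case/and3P: wfx.
pose Inv k s' := progress s s' (fun v => exists2 i : 'I_n, i < k & X i v).
suff [mono snd set] : Inv n (sem (PFor x p) s).
  by split=> // v [i Xiv]; apply: set; exists i.
apply: sem_for => //; first by case: rs.
- move=> k s' u [mono snd set].
  split=> [v /mono|/snd snd' v|v /set]; rewrite arr_set_reg //; exact: snd'.
- by split=> // v [].
move=> k s' lt fr rx [mono snd set].
have rs' : ready s' by apply: frame_ready fr rs.
have [mono' snd' set'] := body (Ordinal lt) s' fr rs' rx.
split=> [v /mono/mono'//|/snd/snd'//|v [i]].
by rewrite (ltS_ord lt) => /orP[/eqP->|ik Xiv]; [apply: set' | apply: mono'; apply: set; exists i].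
Qed.

Lemma all_attempts_progress s : ready s ->
  progress s (sem (PFor 1 (PFor 2 (PFor 3 (PFor 4 attempt)))) s)
    (fun v => exists a b c d, settles a b c d v).
Proof.
move=> rs; apply: for_progress => // a s1 _ rs1 r1.
apply: for_progress => // b s2 fr2 rs2 r2.
apply: for_progress => // c s3 fr3 rs3 r3.
apply: for_progress => // d s4 fr4 rs4 r4.
have g4 : guessed a b c d s4.
  split=> //; last by rewrite (frame_reg fr4).
    by rewrite (frame_reg fr4) // (frame_reg fr3) // (frame_reg fr2).
  by rewrite (frame_reg fr4) // (frame_reg fr3).
have [mono snd set] := attemptP g4.
by split=> // snd4 v /snd[/snd4|].
Qed.

Lemma final_loopP s : ready s -> regs s 10 = 1 ->
  (regs (sem final_loop s) 10 != 0) = [forall v : 'I_n, arr s 4 v != 0].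
Proof.
move=> rs s10.
pose Inv k s' := (regs s' 10 != 0) = [forall v : 'I_n, (v < k) ==> (arr s 4 v != 0)].
suff -> : Inv n (sem final_loop s).
  by apply: eq_forallb => v; rewrite ltn_ord.
apply: sem_for => //; first by case: rs.
  by rewrite /Inv s10; apply/esym/forallP.
move=> k s' lt fr r6 inv; pose v := Ordinal lt; have s'6 : regs s' 6 = v by [].
rewrite /Inv (forall_ltS lt) -inv sem_PIf !evE s'6 (frame_arr fr) //.
by case: ifP.
Qed.

End Correctness.

Lemma eds_prog_correct n (e : rel 'I_n) : simple_graph e ->
    bipartite e -> induced_free (spider 2 2 4) e ->
  regs (sem eds_prog (input e)) 10 <> 0 <-> has_eds e.
Proof.
move=> [sym_e irr_e] [A color] free.
rewrite /eds_prog 2!sem_PSeq.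
have [_ snd set] := all_attempts_progress sym_e irr_e (ready_input e).
have wf1 : wf (PFor 1 (PFor 2 (PFor 3 (PFor 4 attempt)))) by [].
have rs1 := ready_sem wf1 (ready_input e).
set s1 := sem (PFor 1 _) _ in snd set rs1 *.
have rs2 : ready e (sem (PSet 10 (Const 1)) s1) by apply: ready_sem.
have -> : (regs (sem final_loop (sem (PSet 10 (Const 1)) s1)) 10 <> 0) <->
    forall v : 'I_n, arr s1 4 v != 0.
  split=> [/eqP|all]; last apply/eqP; rewrite (final_loopP rs2) //.
    by move=> /forallP all v; have := all v; rewrite sem_PSet arr_set_reg.
  by apply/forallP => v; rewrite sem_PSet arr_set_reg.
split=> [all|[D edsD] v].
  apply: (local_to_global_eds sym_e) => v; apply: snd (all v) => t /=.
  (* Initially no vertex is marked: array 4 lies beyond the matrix, where the input memory is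
     zero. *)
  rewrite /arr /= /adj_mem; case: existsP => // -[i /existsP[j /andP[/eqP]]].
  by have := matrix_index_lt i j; lia.
have [a [b [c [d [[aD bD cD dD] av unamb]]]]] :=
  exists_unambiguous sym_e irr_e free color edsD v.
apply: set; exists a, b, c, d, D; split=> //.
by apply/subsetP => x; rewrite !inE => /orP[/orP[/orP[]|]|] /eqP->.
Qed.

Theorem theorem8 :
  solvable_in_time
    (fun n (e : rel 'I_n) => bipartite e /\ induced_free (spider 2 2 4) e)
    (fun n (e : rel 'I_n) => has_eds e)
    (fun n => n ^ 6).
Proof.
(* [depth eds_prog] computes to 6. *)
apply: (solvable_by_prog (p := eds_prog) (x := 10) wf_eds_prog).
by move=> n e simple_e [bip free]; apply: eds_prog_correct.
Qed.
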